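(* Let $n\ge2$ and let $\Omega\subset\mathbb R^n$ be a bounded domain finitely connected at the boundary. Then for every point $x\in\partial\Omega$ the set of connected components of the fiber $\Phi_x$ coincides with (that is, is in one-to-one correspondence with) the set of prime ends of $\Omega$ with impression $\{x\}$.
   Context: Finite connectedness. $\Omega$ is finitely connected at the boundary if for every $x\in\partial\Omega$ and $r>0$ there is a bounded open set $U$ with $x\in U\subset B(x,r)$ such that $U\cap\Omega$ has only finitely many components. Royden algebra and compactification. The Royden algebra $\mathcal A(\Omega)$ is the algebra of all bounded continuous functions $u:\Omega\to\mathbb R$ (pointwise operations) whose first order weak partial derivatives exist and belong to $L^n(\Omega)$, with norm $\|u\|_{\Omega}=\|u\|_{L^\infty(\Omega)}+\|\nabla u\|_{L^n(\Omega)}$. The Royden compactification $\Omega^*$ is the set of all non-zero bounded linear (multiplicative) homomorphisms $\chi:\mathcal A(\Omega)\to\mathbb R$, with the relative weak$^*$ topology; it is a compact Hausdorff space. A point $x\in\Omega$ is identified with $\hat x\in\Omega^*$, $\hat x(u)=u(x)$. The Royden ideal boundary is $\Delta=\Omega^*\setminus\hat\Omega$, where $\hat\Omega=\{\hat x:x\in\Omega\}$. Fibers. For $x\in\partial\Omega$ the fiber $\Phi_x\subset\Delta$ over $x$ is the set of all $\chi\in\Omega^*$ corresponding to Royden nets converging to $x$, i.e. those $\chi$ for which there is a net $(x_i)$ in $\Omega$ with $x_i\to x$ in $\mathbb R^n$ and $u(x_i)\to\chi(u)$ for every $u\in\mathcal A(\Omega)$. Prime ends of a bounded domain $\Omega$.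 The Mazurkiewicz distance on $\Omega$ is $d_M(x,y)=\inf\operatorname{diam}K$ over connected sets $K\subset\Omega$ containing $x,y$; $\mathrm{dist}_M(A,B)=\inf_{a\in A,b\in B}d_M(a,b)$. A bounded connected set $E\subsetneq\Omega$ is acceptable if $\overline E\cap\partial\Omega\ne\emptyset$. A chain is a sequence $\{E_k\}_{k\ge1}$ of acceptable sets such that for all $k$: (1) $E_{k+1}\subset E_k$; (2) $\mathrm{dist}_M(\Omega\cap\partial E_{k+1},\Omega\cap\partial E_k)>0$; and (3) the impression $\bigcap_k\overline{E_k}$ is contained in $\partial\Omega$. A chain $\{E_k\}$ divides $\{F_k\}$ if for each $k$ there is $l_k$ with $E_{l}\subset F_k$ for all $l\ge l_k$. Two chains are equivalent if they divide each other. An end $[E_k]$ is an equivalence class of chains; its impression is that of any representative; division passes to ends. A prime end is an end not divisible by any other end. *)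

(* Defs.v *)
From HB Require Import structures.
From mathcomp Require Import all_boot all_order all_algebra.
From mathcomp Require Import all_classical all_reals all_analysis.

Set Implicit Arguments.
Unset Strict Implicit.
Unset Printing Implicit Defensive.
Import Order.TTheory GRing.Theory Num.Theory.
Import numFieldNormedType.Exports.
Local Open Scope classical_set_scope.
Local Open Scope ring_scope.

Fact rV_display : measure_display. Proof. exact: (default_measure_display). Qed.

(* R^n is 'rV[R]_n, with the sigma-algebra generated by the coordinates, that is
   the Borel sigma-algebra. *)
Section measurable_rV.
Context (R : realType) (n : nat).

Let coord (i : 'I_n) (x : 'rV[R]_n) : measurableTypeR R := x ord0 i.

Let rV_set0 : g_sigma_preimage coord set0.
Proof. exact: sigma_algebra0. Qed.

Let rV_setC A : g_sigma_preimage coord A -> g_sigma_preimage coord (~` A).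
Proof. exact: sigma_algebraC. Qed.

Let rV_bigcup (F : _^nat) : (forall i, g_sigma_preimage coord (F i)) ->
  g_sigma_preimage coord (\bigcup_i (F i)).
Proof. exact: sigma_algebra_bigcup. Qed.

HB.instance Definition _ := @isMeasurable.Build rV_display
  'rV[R]_n (g_sigma_preimage coord) rV_set0 rV_setC rV_bigcup.

Lemma measurable_coord (i : 'I_n) :
  measurable_fun [set: 'rV[R]_n] (fun x => x ord0 i : measurableTypeR R).
Proof.
move=> _ Y mY; rewrite setTI; apply: sub_sigma_algebra => /=.
rewrite -bigcup_seq/=; exists i => /=; first by rewrite mem_index_enum.
by exists Y => //; rewrite setTI.
Qed.

Lemma measurable_fun_coordP d (T : measurableType d) (f : T -> 'rV[R]_n) :
  (forall i, measurable_fun setT (fun x => f x ord0 i : measurableTypeR R)) ->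
  measurable_fun setT f.
Proof.
move=> mf _ A mA; rewrite setTI.
suff : (g_sigma_preimage coord) `<=` [set A | measurable (f @^-1` A)] by exact.
apply: smallest_sub => /=.
  split => /=.
  - by rewrite preimage_set0.
  - by move=> B /= mB; rewrite setTD preimage_setC; exact: measurableC.
  - by move=> F /= mF; rewrite preimage_bigcup; exact: bigcup_measurable.
move=> B; rewrite -bigcup_seq => -[i _ [C mC <-]] /=.
by rewrite setTI -[X in measurable X]setTI; exact: mf.
Qed.

End measurable_rV.

Definition rV_cons (R : realType) n (p : measurableTypeR R * 'rV[R]_n) :
    'rV[R]_n.+1 :=
  \row_i if unlift ord0 i is Some j then p.2 ord0 j else p.1.

Lemma measurable_rV_cons (R : realType) n :
  measurable_fun setT (@rV_cons R n).
Proof.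
apply: measurable_fun_coordP => i.
under [X in measurable_fun _ X]eq_fun do rewrite mxE.
case: (unlift ord0 i) => [j|]; last exact: measurable_fst.
apply: (@measurableT_comp _ _ _ _ _ _
  (fun x : 'rV[R]_n => x ord0 j : measurableTypeR R)); last exact: measurable_snd.
exact: measurable_coord.
Qed.

Lemma measurable_rV_cons_inv (R : realType) n :
  measurable_fun setT (fun x : 'rV[R]_n.+1 =>
    (x ord0 ord0 : measurableTypeR R, \row_j x ord0 (lift ord0 j))).
Proof.
apply/measurable_fun_pair; first exact: measurable_coord.
apply: measurable_fun_coordP => i.
under [X in measurable_fun _ X]eq_fun do rewrite mxE.
exact: measurable_coord.
Qed.

Lemma rV_consK (R : realType) n : cancel (@rV_cons R n)
  (fun x => (x ord0 ord0 : measurableTypeR R, \row_j x ord0 (lift ord0 j))).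
Proof.
move=> [a v]; rewrite /rV_cons/= mxE unlift_none; congr pair.
by apply/rowP => j; rewrite !mxE liftK.
Qed.

Section lebesgue_step.
Context (R : realType) (n : nat)
  (mu : {sigma_finite_measure set 'rV[R]_n -> \bar R}).
Local Open Scope ereal_scope.

Definition lebesgue_step : set 'rV[R]_n.+1 -> \bar R :=
  pushforward ((@lebesgue_measure R) \x mu) (@rV_cons R n).

Let pre A : measurable A -> measurable (@rV_cons R n @^-1` A).
Proof.
by move=> mA; rewrite -[X in measurable X]setTI; exact: (@measurable_rV_cons R n).
Qed.

Let step0 : lebesgue_step set0 = 0.
Proof. by rewrite /lebesgue_step /pushforward preimage_set0 measure0. Qed.

Let step_ge0 A : 0 <= lebesgue_step A.
Proof. exact: (measure_ge0 ((@lebesgue_measure R) \x mu)). Qed.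

Let step_sigma_additive : semi_sigma_additive lebesgue_step.
Proof.
move=> F mF tF mUF; rewrite /lebesgue_step /pushforward preimage_bigcup.
apply: measure_semi_sigma_additive.
- by move=> k; exact: pre.
- apply/trivIsetP => /= i j _ _ ij; rewrite -preimage_setI.
  by move/trivIsetP : tF => /(_ _ _ _ _ ij) ->//; rewrite preimage_set0.
- by rewrite -preimage_bigcup; exact: pre.
Qed.

HB.instance Definition _ := isMeasure.Build _ _ _ lebesgue_step
  step0 step_ge0 step_sigma_additive.

Let step_sigma_finite : sigma_finite setT lebesgue_step.
Proof.
have /sigma_finiteP[F [TF ndF Foo]] := sigma_finiteT (@lebesgue_measure R).
have /sigma_finiteP[G [TG ndG Goo]] := sigma_finiteT mu.
set g := fun x : 'rV[R]_n.+1 =>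
  (x ord0 ord0 : measurableTypeR R, \row_j x ord0 (lift ord0 j) : 'rV[R]_n).
exists (fun k => g @^-1` (F k `*` G k)).
  rewrite -preimage_bigcup -(preimage_setT g) -setXTT TF TG; congr (_ @^-1` _).
  apply/seteqP; split => [[x y] [/= [k _ Fx] [l _ Gy]]|[x y] [k _ [/= Fx Gy]]].
    exists (maxn k l) => //; split.
    - by move: x Fx; exact/subsetPset/ndF/leq_maxl.
    - by move: y Gy; exact/subsetPset/ndG/leq_maxr.
  by split; exists k.
move=> k; have [? ?] := Foo k; have [? ?] := Goo k; split.
  rewrite -[X in measurable X]setTI.
  by apply: (@measurable_rV_cons_inv R n) => //; exact: measurableX.
rewrite /lebesgue_step /pushforward.
rewrite (_ : _ @^-1` _ = F k `*` G k); last first.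
  by apply/seteqP; split => p; rewrite /preimage /mkset /g (@rV_consK R n).
by rewrite product_measure1E// lte_mul_pinfty// ge0_fin_numE.
Qed.

HB.instance Definition _ := @Measure_isSigmaFinite.Build _ _ _ lebesgue_step
  step_sigma_finite.

End lebesgue_step.

(* n-dimensional Lebesgue measure, as an iterated product measure. *)
Fixpoint lebesgue_rV (R : realType) n :
    {sigma_finite_measure set 'rV[R]_n -> \bar R} :=
  match n with
  | 0 => dirac (0 : 'rV[R]_0)
  | m.+1 => lebesgue_step (lebesgue_rV R m)
  end.

Lemma lebesgue_rV_box (R : realType) n
    (A : 'I_n -> set (measurableTypeR R)) :
  (forall i, measurable (A i)) ->
  (lebesgue_rV R n [set x | forall i, A i (x ord0 i)] =
  \big[*%E/1%E]_i lebesgue_measure (A i))%E.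
Proof.
elim: n A => [|n ih] A mA.
  by rewrite big_ord0 /= diracE mem_set//=; case.
rewrite big_ord_recl -ih; last by move=> i; exact: mA.
rewrite /= /lebesgue_step /pushforward -product_measure1E//.
  congr (_ _); apply/seteqP; split => -[a v]/=.
    move=> H; split; first by have := H ord0; rewrite mxE unlift_none.
    by move=> i; have := H (lift ord0 i); rewrite mxE liftK.
  move=> [H1 H2] i; rewrite mxE; case: unliftP => [j ->|->] //=.
rewrite [X in measurable X](_ : _ = \bigcap_(i in [set: 'I_n])
    ((fun x : 'rV[R]_n => x ord0 i : measurableTypeR R) @^-1`
     A (lift ord0 i))).
  apply: fin_bigcap_measurable => // i _.
  by rewrite -[X in measurable X]setTI; apply: measurable_coord.
by apply/seteqP; split => x /= H i; [move=> _; exact: H|exact: H].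
Qed.

Section euclidean.
Context (R : realType) (n : nat).
Implicit Types (x y : 'rV[R]_n) (A B K : set 'rV[R]_n).

(* The library norm on 'rV[R]_n is the sup norm; it induces the same topology
   and the same bounded sets, but not the same balls and diameters. *)
Definition enorm x : R := Num.sqrt (\sum_i x ord0 i ^+ 2).

Definition eball x (r : R) : set 'rV[R]_n := [set y | enorm (x - y) < r].

Definition diam A : \bar R :=
  ereal_sup [set (enorm (x - y))%:E | x in A & y in A].

Definition boundary A : set 'rV[R]_n := closure A `\` A°.

Definition bounded_domain A :=
  [/\ open A, connected A, A !=set0 & bounded_set A].

End euclidean.

Definition components (T : topologicalType) (A : set T) : set (set T) :=
  [set connected_component A x | x in A].

Definition finitely_connected_at_boundary (R : realType) n
    (Omega : set 'rV[R]_n) :=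
  forall x r, boundary Omega x -> 0 < r ->
  exists U : set 'rV[R]_n, [/\ open U, bounded_set U, U x, U `<=` eball x r &
    finite_set (components (U `&` Omega))].

Section weak_derivatives.
Context (R : realType) (n : nat).
Implicit Types (Omega : set 'rV[R]_n) (u v f phi : 'rV[R]_n -> R).

Definition unit_vector (i : 'I_n) : 'rV[R]_n := delta_mx ord0 i.

Fixpoint Ck (k : nat) f : Prop :=
  match k with
  | 0 => continuous f
  | k'.+1 => forall i : 'I_n, (forall x, derivable f x (unit_vector i)) /\
                              Ck k' ('D_(unit_vector i) f)
  end.

Definition test_function Omega phi :=
  [/\ forall k, Ck k phi, compact (closure [set x | phi x != 0]) &
      closure [set x | phi x != 0] `<=` Omega].

Definition locally_integrable_on Omega v :=
  forall K, compact K -> K `<=` Omega ->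
  (lebesgue_rV R n).-integrable K (EFin \o v).

Definition weak_partial Omega u (i : 'I_n) v :=
  locally_integrable_on Omega v /\
  forall phi, test_function Omega phi ->
    \int[lebesgue_rV R n]_(x in Omega) (u x * 'D_(unit_vector i) phi x) =
    - \int[lebesgue_rV R n]_(x in Omega) (v x * phi x).

Definition weak_gradient Omega u (g : 'rV[R]_n -> 'rV[R]_n) :=
  forall i, weak_partial Omega u i (fun x => g x ord0 i).

Definition Lnorm_on Omega (p : \bar R) f : \bar R :=
  'N[lebesgue_rV R n]_p [EFin \o (f \_ Omega)].

Definition in_Lp Omega (p : \bar R) f :=
  measurable_fun Omega f /\ (Lnorm_on Omega p f < +oo)%E.

End weak_derivatives.

Section royden.
Context (R : realType) (n : nat) (Omega : set 'rV[R]_n).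
Local Notation p := (n%:R%:E : \bar R).

(* 'valL_0 u is the extension by 0 of u : Omega -> R to all of R^n. *)
Definition royden_algebra : set (Omega -> R) :=
  [set u | [/\ continuous u, (exists M : R, forall x, `|u x| <= M) &
    exists2 g, weak_gradient Omega ('valL_0%R u) g &
      forall i, in_Lp Omega p (fun x => g x ord0 i)]].

(* Weak gradients are unique only up to null sets; any of them will do. *)
Definition gradient (u : Omega -> R) : 'rV[R]_n -> 'rV[R]_n :=
  xget (fun=> 0) [set g | weak_gradient Omega ('valL_0%R u) g].

Definition royden_norm (u : Omega -> R) : \bar R :=
  (Lnorm_on Omega +oo ('valL_0%R u) +
   Lnorm_on Omega p (fun x => enorm (gradient u x)))%E.

Implicit Types (chi : {ptws royden_algebra -> R}) (u v w : royden_algebra).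

(* royden_algebra is a set of functions, without an algebra structure:
   linearity and multiplicativity are stated for all u, v, w in it
   such that w is the pointwise combination of u and v. *)
Definition royden_character chi :=
  [/\ forall (a : R) u v w,
        (forall x, set_val w x = a * set_val u x + set_val v x) ->
        chi w = a * chi u + chi v,
      forall u v w, (forall x, set_val w x = set_val u x * set_val v x) ->
        chi w = chi u * chi v,
      exists C : R, forall u,
        (`|chi u|%:E <= C%:E * royden_norm (set_val u))%E &
      exists u, chi u != 0].

(* {ptws _ -> R} carries the topology of pointwise convergence, so that its
   subsets have the relative weak* topology. *)
Definition royden_compactification : set {ptws royden_algebra -> R} :=
  [set chi | royden_character chi].

Definition evaluation (x : Omega) : {ptws royden_algebra -> R} :=
  fun u => set_val u x.

Definition royden_boundary : set {ptws royden_algebra -> R} :=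
  royden_compactification `\` range evaluation.

End royden.

Arguments royden_algebra {R n} Omega _.
Arguments royden_compactification {R n} Omega _.
Arguments royden_boundary {R n} Omega _.

Definition directed (I : Type) (le : I -> I -> Prop) :=
  [/\ inhabited I, forall i, le i i,
      forall i j k, le i j -> le j k -> le i k &
      forall i j, exists k, le i k /\ le j k].

Definition net_tails (I : Type) (le : I -> I -> Prop) : set_system I :=
  [set P | exists i, forall j, le i j -> P j].

Definition fiber (R : realType) n (Omega : set 'rV[R]_n) (x : 'rV[R]_n) :
    set {ptws royden_algebra Omega -> R} :=
  [set chi | royden_boundary Omega chi /\
    exists (I : Type) (le : I -> I -> Prop) (s : I -> Omega),
    [/\ directed le,
        set_val (s i) @[i --> net_tails le] --> x &
        forall u : royden_algebra Omega,
          set_val u (s i) @[i --> net_tails le] --> chi u]].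

Arguments fiber {R n} Omega x _.

Section prime_ends.
Context (R : realType) (n : nat) (Omega : set 'rV[R]_n).
Implicit Types (x y : 'rV[R]_n) (A B : set 'rV[R]_n).
Implicit Types (E F : nat -> set 'rV[R]_n).

Definition mazurkiewicz x y : \bar R :=
  ereal_inf [set diam K | K in
    [set K | [/\ connected K, K `<=` Omega, K x & K y]]].

Definition mazurkiewicz_dist A B : \bar R :=
  ereal_inf [set mazurkiewicz a b | a in A & b in B].

Definition acceptable A :=
  [/\ bounded_set A, connected A, A `<` Omega &
      closure A `&` boundary Omega !=set0].

Definition chain_impression E : set 'rV[R]_n := \bigcap_k closure (E k).

Definition chain E :=
  [/\ forall k, acceptable (E k),
      forall k, E k.+1 `<=` E k,
      forall k, (0 < mazurkiewicz_dist (Omega `&` boundary (E k.+1))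
                                       (Omega `&` boundary (E k)))%E &
      chain_impression E `<=` boundary Omega].

Definition divides E F :=
  forall k, exists l0, forall l, (l0 <= l)%N -> E l `<=` F k.

Definition chain_equiv E F := divides E F /\ divides F E.

Implicit Types e : set (nat -> set 'rV[R]_n).

(* An end is the set of all chains equivalent to a given chain. *)
Definition is_end e :=
  exists2 E, chain E & e = [set F | chain F /\ chain_equiv E F].

Definition end_divides e1 e2 := exists E F, [/\ e1 E, e2 F & divides E F].

Definition prime_end e :=
  is_end e /\ forall e', is_end e' -> end_divides e' e -> e' = e.

Definition end_has_impression e A := forall E, e E -> chain_impression E = A.

End prime_ends.

(* Main.v *)
(* Fix radii r_k decreasing to 0 and call branch a decreasing sequence (G_k) in
   which G_k is a component of Omega `&` B(x, r_k).  Both sides of the theorem are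
   parametrised by branches.

   Prime ends: a branch is a chain with impression {x}, since Omega `&` boundary G_k
   lies on the sphere of radius r_k.  Any chain E with impression {x} divides the
   branch of the components containing its tails; conversely, if some E_m contained
   no G_k, each G_k would meet both boundary E_m and boundary E_(m+1), although
   diam G_k tends to 0.  So every end with impression {x} is the end of a
   unique branch, and it is prime.

   Fibers: the branch (G_k) corresponds to the intersection of the closures of
   the images of the G_k in the Royden compactification, a decreasing sequence
   of compact connected sets.  A C^1 bump around x, cut off to a component
   of Omega `&` B(x, r_k), is in the Royden algebra, and a character in the fiber
   takes only the values 0 and its maximum on it: this separates branches.  Since
   only finitely many of these components come close to x, each character of
   the fiber selects one of them for every k. *)
Require Import Defs.
From HB Require Import structures.
From mathcomp Require Import all_boot all_order all_algebra.
From mathcomp Require Import all_classical all_reals all_analysis.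
From mathcomp Require Import measurable_realfun ess_sup_inf ring lra.
Import Order.TTheory GRing.Theory Num.Theory.
Import numFieldNormedType.Exports.
Local Open Scope classical_set_scope.
Local Open Scope ring_scope.

(** * Lebesgue measure on R^n *)

(** Balls of the sup norm are cubes. Positivity of [e] is part of membership in a matrix ball, and
    for [n = 0] the coordinate condition alone would be vacuous. *)
Lemma ball_rVE (R : realType) n (x : 'rV[R]_n) e : 0 < e ->
  ball x e = [set y | forall i, ball (x ord0 i) e (y ord0 i)].
Proof.
move=> e0; apply/seteqP; split=> y; first by move=> [_ H] i; exact: H.
by move=> H; split=> // i j; rewrite (ord1 i); exact: H.
Qed.

Lemma ball_rV_measurable (R : realType) n (x : 'rV[R]_n) e :
  measurable (ball x e).
Proof.
have [e0|e0] := ltP 0 e; last first.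
  rewrite (_ : ball x e = set0); first exact: measurable0.
  by apply/seteqP; split=> y // [] /(le_lt_trans e0); rewrite ltxx.
rewrite ball_rVE//.
rewrite [X in measurable X](_ : _ = \bigcap_(i in [set: 'I_n])
    ((fun y : 'rV[R]_n => y ord0 i : measurableTypeR R) @^-1`
     ball (x ord0 i) e)).
  apply: fin_bigcap_measurable => // i _.
  rewrite -[X in measurable X]setTI; apply: measurable_coord => //.
  exact: open_measurable (ball_open _ _).
by apply/seteqP; split => y /= H i; [move=> _; exact: H|exact: H].
Qed.

(** [A] is the union of the countably many balls with rational centre and radius [1/(k+1)] that it
    contains. Sup-norm balls are finite intersections of coordinate preimages, so they lie in the
    sigma-algebra generated by the coordinates. *)
Lemma open_measurable_rV (R : realType) n (A : set 'rV[R]_n) :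
  open A -> measurable A.
Proof.
move=> oA.
pose F (p : 'rV[rat]_n * nat) : set 'rV[R]_n :=
  [set y | ball (map_mx ratr p.1 : 'rV[R]_n) p.2.+1%:R^-1 y /\
    ball (map_mx ratr p.1 : 'rV[R]_n) p.2.+1%:R^-1 `<=` A].
have -> : A = \bigcup_p F p.
  apply/seteqP; split=> [y Ay|y [p _ [yp pA]]]; last exact: pA.
  have [e /= e0 eA] : nbhs_ball y A by apply/nbhs_ballP; exact: open_nbhs_nbhs.
  (* The centre will lie within [1/(k+1)] of [y], so the ball around it reaches at most [2/(k+1)]
     from [y]. *)
  have [k k0] : exists k : nat, k.+1%:R^-1 < e / 2 :> R.
    have [|k] := @ltr_add_invr R 0 (e / 2); first by rewrite divr_gt0.
    by rewrite add0r; exists k.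
  have /choice[q hq] : forall i : 'I_n, exists q : rat,
      ball (y ord0 i) k.+1%:R^-1 (ratr q : R).
    move=> i; have [|q] := @rat_in_itvoo R (y ord0 i - k.+1%:R^-1) (y ord0 i + k.+1%:R^-1).
      by rewrite ltrD2l gtrN ?invr_gt0.
    rewrite in_itv/= => H; exists q.
    by rewrite /ball /= distrC ltr_distl.
  have yq : ball (map_mx ratr (\row_i q i) : 'rV[R]_n) k.+1%:R^-1 y.
    rewrite ball_rVE ?invr_gt0// => i; rewrite !mxE; apply: ball_sym; exact: hq.
  exists (\row_i q i, k) => //; split => //= z zq; apply: eA.
  apply: (@le_ball _ _ _ (k.+1%:R^-1 + k.+1%:R^-1)).
    by rewrite [e]splitr lerD// ltW.
  exact: ball_triangle (ball_sym yq) zq.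
apply: countable_bigcupT_measurable; first exact: countableP.
move=> p; rewrite /F.
have [pA|pA] := pselect (ball (map_mx ratr p.1 : 'rV[R]_n) p.2.+1%:R^-1 `<=` A).
  rewrite [X in measurable X](_ : _ = ball (map_mx ratr p.1 : 'rV[R]_n) p.2.+1%:R^-1).
    exact: ball_rV_measurable.
  by apply/seteqP; split=> // z [].
rewrite [X in measurable X](_ : _ = set0); first exact: measurable0.
by apply/seteqP; split=> // z [].
Qed.

Lemma closed_measurable_rV (R : realType) n (A : set 'rV[R]_n) :
  closed A -> measurable A.
Proof.
move=> cA; rewrite -[A]setCK; apply: measurableC; apply: open_measurable_rV.
exact: closed_openC.
Qed.

Lemma continuous_measurable_rV (R : realType) n (f : 'rV[R]_n -> R) :
  continuous f -> measurable_fun setT f.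
Proof.
move=> /continuousP cf; apply: (measurability _ (RGenOpens.measurableE R)) => //.
move=> _ [_ [a [b ->] <-]]; rewrite setTI; apply: open_measurable_rV.
by apply: cf; exact: interval_open.
Qed.

Lemma lebesgue_rV_ball (R : realType) n (x : 'rV[R]_n) e : 0 < e ->
  lebesgue_rV R n (ball x e) = ((e *+ 2) ^+ n)%:E.
Proof.
move=> e0; rewrite ball_rVE//.
rewrite (@lebesgue_rV_box R n (fun i => ball (x ord0 i) e)); last first.
  by move=> i; exact: open_measurable (ball_open _ _).
under eq_bigr do rewrite lebesgue_measure_ball ?ltW//.
by rewrite prodEFin prodr_const card_ord.
Qed.

Lemma lebesgue_rV_bounded (R : realType) n (A : set 'rV[R]_n) :
  measurable A -> bounded_set A -> (lebesgue_rV R n A < +oo)%E.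
Proof.
move=> mA [M [_ AM]].
(* Boundedness gives the bound [K] only for [K] strictly above [M]. The value [|M| + 1] is such a
   [K], and the radius [|M| + 2] makes the inequality strict. *)
have M1 : M < `|M| + 1 by rewrite ltr_pwDr// ler_norm.
have e0 : 0 < `|M| + 2 :> R by rewrite ltr_wpDl.
apply: (@le_lt_trans _ _ (lebesgue_rV R n (ball 0 (`|M| + 2)))).
  apply: le_measure; rewrite ?inE//; first exact: ball_rV_measurable.
  move=> y Ay; rewrite -ball_normE /ball_/= sub0r normrN.
  by apply: (le_lt_trans (AM _ M1 _ Ay)); rewrite ltrD2l ltr1n.
by rewrite lebesgue_rV_ball// ltry.
Qed.

Lemma lebesgue_rV_open_gt0 (R : realType) n (A : set 'rV[R]_n) :
  open A -> A !=set0 -> (0 < lebesgue_rV R n A)%E.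
Proof.
move=> oA [x Ax].
have [e /= e0 eA] : nbhs_ball x A by apply/nbhs_ballP; exact: open_nbhs_nbhs.
apply: (@lt_le_trans _ _ (lebesgue_rV R n (ball x e))).
  by rewrite lebesgue_rV_ball// lte_fin exprn_gt0// mulrn_wgt0.
apply: le_measure; rewrite ?inE//; first exact: ball_rV_measurable.
exact: open_measurable_rV.
Qed.

Lemma closed_ball0_compact (R : realType) n (M : R) :
  compact [set y : 'rV[R]_n | `|y| <= M].
Proof.
apply: bounded_closed_compact.
  by exists M; split; [exact: num_real|move=> K MK y /= /le_trans -> //; exact: ltW].
rewrite (_ : mkset _ = (fun y : 'rV[R]_n => `|y|) @^-1` [set t : R | t <= M]) //.
apply: closed_comp; last exact: closed_le.
by move=> y _; exact: norm_continuous.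
Qed.

Lemma continuous_support_bounded (R : realType) n (G : 'rV[R]_n -> R) (M : R) :
  continuous G -> (forall y, ~ ball 0 M y -> G y = 0) ->
  exists2 C : R, 0 <= C & forall y, `|G y| <= C.
Proof.
move=> cG G0.
have := continuous_compact (continuous_subspaceT cG) (closed_ball0_compact R n M).
move=> /compact_bounded[C [_ GC]].
have CC : C < `|C| + 1 by rewrite ltr_pwDr// ler_norm.
exists (`|C| + 1); first by rewrite addr_ge0.
move=> y; have [yM|yM] := leP `|y| M; first by apply: GC CC _ _; exists y.
rewrite G0 ?normr0 ?addr_ge0// -ball_normE /ball_/= sub0r normrN.
by apply/negP; rewrite -leNgt ltW.
Qed.

Lemma integrable_continuous_support (R : realType) n (G : 'rV[R]_n -> R) (M : R) :
  continuous G -> (forall y, ~ ball 0 M y -> G y = 0) ->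
  (lebesgue_rV R n).-integrable setT (EFin \o G).
Proof.
move=> cG G0.
have mG := continuous_measurable_rV _ _ _ cG.
have mb : measurable (ball (0 : 'rV[R]_n) M) by exact: ball_rV_measurable.
have -> : EFin \o G = (EFin \o G) \_ (ball 0 M).
  apply/funext => y; rewrite patchE; case: ifPn => // /negP.
  by rewrite inE => /G0 /= ->.
apply/(integrable_mkcond _ mb)/measurable_bounded_integrable => //.
- apply: lebesgue_rV_bounded => //; exists M; split; first exact: num_real.
  move=> K MK y; rewrite -ball_normE /ball_/= sub0r normrN => /ltW/le_trans; apply.
  exact: ltW.
- exact: measurable_funTS.
- have [C C0 GC] := continuous_support_bounded _ _ _ _ cG G0.
  exists C; split; first exact: num_real.
  by move=> K CK y _ /=; apply: le_trans (GC y) (ltW CK).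
Qed.

(** * The integral of a partial derivative with compact support *)

(** The measure in dimension [n.+1] is by construction a pushforward along [rV_cons], so this is the
    change of variables that opens the way to Fubini. *)
Lemma integral_rV_cons (R : realType) n (G : 'rV[R]_n.+1 -> \bar R) :
  (lebesgue_rV R n.+1).-integrable setT G ->
  ((lebesgue_measure \x lebesgue_rV R n)%E.-integrable setT (G \o @rV_cons R n)
  /\ \int[lebesgue_rV R n.+1]_y G y =
     \int[(lebesgue_measure \x lebesgue_rV R n)%E]_p G (rV_cons p))%E.
Proof.
move=> iG; have [mG G_fin] := integrableP _ _ _ iG.
have iGc : (lebesgue_measure \x lebesgue_rV R n)%E.-integrable setT
    (G \o @rV_cons R n).
  apply/integrableP; split.
    by apply: measurableT_comp => //; exact: measurable_rV_cons.
  move: G_fin; rewrite /= /lebesgue_step ge0_integral_pushforward//.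
  - exact: measurable_rV_cons.
  - exact: measurableT_comp.
split=> //.
by rewrite /= /lebesgue_step integral_pushforward//; exact: measurable_rV_cons.
Qed.

(* A directional derivative depends only on the values along the line. *)
Lemma is_derive_shift_eq (R : realType) (V W : normedModType R) (f : V -> R)
    (g : W -> R) (a v : V) (b w : W) (df : R) :
  (forall h : R, f (h *: v + a) = g (h *: w + b)) ->
  is_derive b w g df -> is_derive a v f df.
Proof.
move=> fg [dg dgE].
have E : (fun h : R => h^-1 *: ((f \o shift a) (h *: v) - f a)) =
         (fun h : R => h^-1 *: ((g \o shift b) (h *: w) - g b)).
  apply/funext => h /=; rewrite fg; have := fg 0; rewrite !scale0r !add0r => -> //.
by split; [rewrite /derivable E|rewrite /derive E].
Qed.

Lemma rV_cons_shift0 (R : realType) n (h a b : R) (v : 'rV[R]_n) :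
  rV_cons (h *: (b : R^o) + a, v) = h *: (b *: unit_vector R ord0) + rV_cons (a, v).
Proof.
apply/rowP => j; rewrite !mxE/=; case: unliftP => [k ->|->].
  by rewrite (_ : (lift ord0 k == ord0) = false)//= ?andbF !mulr0 add0r.
by rewrite eqxx/= mulr1.
Qed.

Lemma rV_cons_shiftS (R : realType) n (h a : R) (v w : 'rV[R]_n) i :
  rV_cons (a, h *: unit_vector R i + v) =
  h *: unit_vector R (lift ord0 i) + rV_cons (a, v).
Proof.
apply/rowP => j; rewrite !mxE/=; case: unliftP => [k ->|->].
  by rewrite !mxE/= (inj_eq lift_inj).
by rewrite (_ : (ord0 == lift ord0 i) = false)// mulr0 add0r.
Qed.

Lemma continuous_rV_consl (R : realType) n (v : 'rV[R]_n) :
  continuous (fun a : R => rV_cons (a, v)).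
Proof.
move=> a A /nbhs_ballP[e e0 eA]; apply/nbhs_ballP; exists e => //= b ab; apply: eA.
rewrite ball_rVE// => j; rewrite !mxE /=; case: (unlift ord0 j) => [k|] //.
exact: ballxx.
Qed.

Lemma continuous_rV_consr (R : realType) n (a : R) :
  continuous (fun v : 'rV[R]_n => rV_cons (a, v)).
Proof.
move=> v A /nbhs_ballP[e e0 eA]; apply/nbhs_ballP; exists e => //= w vw.
apply: eA; move: vw.
rewrite !ball_rVE// => H j; rewrite !mxE /=; case: (unlift ord0 j) => [k|].
  exact: H.
exact: ballxx.
Qed.

(** Fundamental theorem of calculus on an interval [[-c, c]] whose endpoints lie outside the
    support, so that [F] vanishes at both. *)
Lemma integral_derive_support (R : realType) (F G : R -> R) (M : R) :
  (forall t : R, is_derive t 1 F (G t)) -> continuous G ->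
  (forall t, ~ ball 0 M t -> F t = 0 /\ G t = 0) ->
  (\int[lebesgue_measure]_t (G t)%:E = 0)%E.
Proof.
move=> dF cG FG0; pose c := `|M| + 1.
have c0 : - c < c by rewrite gtrN// ltr_pwDr.
have out t : ~ (- c < t < c) -> F t = 0 /\ G t = 0.
  move=> tc; apply: FG0 => /=; rewrite /ball /= sub0r normrN => tM; apply: tc.
  rewrite -ltr_norml (lt_trans tM)// /c ltr_pwDr// ler_norm//.
have cF : continuous F.
  move=> t; apply: differentiable_continuous; apply/derivable1_diffP.
  exact: ex_derive.
rewrite (_ : (fun t => _) = (EFin \o G) \_ `[- c, c]); last first.
  apply/funext => t; rewrite patchE; case: ifPn => // /negP; rewrite inE/= in_itv/= => tc.
  rewrite (out t _).2// => /andP[t1 t2]; apply: tc.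
  by rewrite !ltW.
rewrite -integral_mkcond (@continuous_FTC2 _ G F)//.
- by rewrite (out c _).1 ?(out (- c) _).1 ?subee// ltxx ?andbF.
- exact: continuous_subspaceT.
- split; first by move=> t _; exact: ex_derive.
    by apply: cvg_at_right_filter; exact: cF.
  by apply: cvg_at_left_filter; exact: cF.
- by move=> t _; rewrite derive1E; apply: derive_val.
Qed.

(** Induction on the dimension with Fubini, integrating first over the variables that include the
    direction [i]. If [i] is a later coordinate, the inner integral over the remaining coordinates
    vanishes by induction; if [i] is the first one, the inner integral is one-dimensional. *)
Lemma integral_partial_support (R : realType) n (F G : 'rV[R]_n -> R)
    (i : 'I_n) (M : R) :
  (forall y, is_derive y (unit_vector R i) F (G y)) -> continuous G ->
  (forall y, ~ ball 0 M y -> F y = 0 /\ G y = 0) ->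
  (\int[lebesgue_rV R n]_y (G y)%:E = 0)%E.
Proof.
elim: n F G i => [|n ih] F G i dF cG FG0; first by case: i {dF}.
have G0 y : ~ ball 0 M y -> G y = 0 by move=> /FG0[].
have := integrable_continuous_support _ _ _ _ cG G0.
move=> /integral_rV_cons[iG ->].
have ball_cons a v : ball 0 M (rV_cons (a, v) : 'rV[R]_n.+1) ->
    ball (0 : R) M a /\ ball (0 : 'rV[R]_n) M v.
  have [M0|M0] := ltP 0 M; last by case => /(le_lt_trans M0); rewrite ltxx.
  rewrite !ball_rVE// => H; split.
    by have := H ord0; rewrite !mxE /= unlift_none.
  by move=> j; have := H (lift ord0 j); rewrite !mxE /= liftK.
case: (unliftP ord0 i) => [j|] iE; subst i.
  rewrite -integral12_prod_meas1//.
  rewrite (_ : fubini_F _ _ = cst 0)%E; first by rewrite integral0.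
  apply/funext => a /=; rewrite /fubini_F /=.
  apply: (ih (fun v => F (rV_cons (a, v))) (fun v => G (rV_cons (a, v))) j).
  - move=> v; apply: is_derive_shift_eq (dF (rV_cons (a, v))) => h.
    by rewrite rV_cons_shiftS.
  - by move=> v; apply: continuous_comp; [exact: continuous_rV_consr|exact: cG].
  - by move=> v Mv; apply: FG0 => /ball_cons[].
rewrite -integral21_prod_meas1//.
rewrite (_ : fubini_G _ _ = cst 0)%E; first by rewrite integral0.
apply/funext => v /=; rewrite /fubini_G /=.
apply: (@integral_derive_support _ (fun a => F (rV_cons (a, v)))
  (fun a => G (rV_cons (a, v))) M).
- move=> a; apply: is_derive_shift_eq (dF (rV_cons (a, v))) => h.
  by rewrite rV_cons_shift0 scale1r.
- by move=> a; apply: continuous_comp; [exact: continuous_rV_consl|exact: cG].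
- by move=> a Ma; apply: FG0 => /ball_cons[].
Qed.

(** * Membership in the Royden algebra *)

Lemma restrT (T : Type) (R : realType) (f : T -> R) (A : set T) x :
  A x -> (f \_ A) x = f x.
Proof. by move=> Ax; rewrite patchE mem_set. Qed.

Lemma restrF (T : Type) (R : realType) (f : T -> R) (A : set T) x :
  ~ A x -> (f \_ A) x = 0.
Proof. by move=> Ax; rewrite patchE memNset. Qed.

(** * Regularity of extensions by zero from an open set *)

Section restrict_open.
Context (R : realType) (V : normedModType R) (G : set V).
Hypothesis oG : open G.

Lemma near_restr_in (f : V -> R) (y : V) : G y -> \forall z \near y, (f \_ G) z = f z.
Proof.
move=> Gy; near=> z; apply: restrT; near: z; exact: open_nbhs_nbhs.
Unshelve. all: by end_near. Qed.

Lemma near_restr_out (f : V -> R) (y : V) :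
  (\forall z \near y, G z -> f z = 0) -> \forall z \near y, (f \_ G) z = 0.
Proof.
apply: filterS => z H; have [Gz|Gz] := pselect (G z); last exact: restrF.
by rewrite restrT// H.
Qed.

Lemma continuous_at_restr (f : V -> R) (y : V) : continuous_at y f ->
  (~ G y -> \forall z \near y, G z -> f z = 0) ->
  continuous_at y (f \_ G).
Proof.
move=> cf f0; have [Gy|Gy] := pselect (G y).
  have H := near_restr_in f y Gy.
  rewrite /continuous_at. rewrite /continuous_at restrT//.
  by apply: cvg_trans cf; apply: near_eq_cvg; apply: filterS H => z ->.
have H := near_restr_out f y (f0 Gy).
rewrite /continuous_at restrF//.
apply: cvg_trans (cvg_cst (0 : R)).
by apply: near_eq_cvg; apply: filterS H => z ->.
exact: nbhs_filter.
Qed.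

Lemma is_derive_restr (f df : V -> R) (v y : V) : is_derive y v f (df y) ->
  (~ G y -> \forall z \near y, G z -> f z = 0) ->
  is_derive y v (f \_ G) ((df \_ G) y).
Proof.
move=> fdf f0; have [Gy|Gy] := pselect (G y).
  rewrite restrT//; apply: near_eq_is_derive fdf.
  by apply: filterS (near_restr_in f y Gy) => z ->.
rewrite restrF//; apply: (@near_eq_is_derive _ _ _ (cst 0)).
  by apply: filterS (near_restr_out f y (f0 Gy)) => z ->.
Qed.

End restrict_open.

(** If [f] vanishes near [y], it vanishes near every point close to [y], where its derivative is
    that of a constant. *)
Lemma is_derive_near0 (R : realType) (V : normedModType R) (f df : V -> R)
    (v y : V) :
  (forall z, is_derive z v f (df z)) ->
  (\forall z \near y, f z = 0) -> \forall z \near y, df z = 0.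
Proof.
move=> fdf f0; have := near_join f0; apply: filterS => z fz.
have <- : 'D_v f z = df z by apply: derive_val.
by rewrite (@near_eq_derive _ _ _ f (cst 0)) ?derive_cst.
Qed.

Lemma valL0E (T : Type) (R : realType) (A : set T) (f : T -> R) :
  'valL_(0 : R) (fun z : A => f (set_val z)) = f \_ A.
Proof. exact: (congr1 (fun h => h f) (sigLK (A := A) (0 : R))). Qed.

Lemma in_Lp_bounded (R : realType) n (Omega : set 'rV[R]_n) (g : 'rV[R]_n -> R)
    (p : nat) (C : R) :
  measurable Omega -> bounded_set Omega -> (0 < p)%N -> measurable_fun setT g ->
  (forall x, Omega x -> `|g x| <= C) -> in_Lp Omega p%:R%:E g.
Proof.
move=> mO bO p0 mg gC; split; first exact: measurable_funTS.
rewrite /Lnorm_on unlock; apply: poweR_lty.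
rewrite (_ : (fun x => _) = (fun x => (`|g x| `^ p%:R)%:E) \_ Omega); last first.
  apply/funext => x /=; have [Ox|Ox] := pselect (Omega x).
    by rewrite restrT// patchE mem_set.
  (* Off [Omega] the integrand is zero to the power [p], which is zero only because [p] is
     nonzero. *)
  rewrite restrF// patchE memNset//= normr0 powR0//.
  by rewrite pnatr_eq0 -lt0n.
rewrite -integral_mkcond.
apply: (@le_lt_trans _ _ ((C `^ p%:R)%:E * lebesgue_rV R n Omega)%E).
  rewrite -(integral_cst _ mO); apply: (ge0_le_integral _ mO).
  - by move=> x _; rewrite lee_fin powR_ge0.
  - apply/measurable_EFinP; apply: measurable_funTS.
    by apply: (measurableT_comp (measurable_powR _)); exact: measurableT_comp.
  - exact: measurable_cst.
  - by move=> x Ox; rewrite lee_fin ge0_ler_powR// ?nnegrE// ?(le_trans _ (gC x Ox)) ?gC.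
by rewrite lte_mul_pinfty ?lee_fin ?powR_ge0// lebesgue_rV_bounded.
Qed.

Lemma continuous_bounded_on (R : realType) n (A : set 'rV[R]_n)
    (g : 'rV[R]_n -> R) :
  bounded_set A -> continuous g -> exists C : R, forall x, A x -> `|g x| <= C.
Proof.
move=> [M [_ AM]] cg.
have := continuous_compact (continuous_subspaceT cg) (closed_ball0_compact R n (`|M| + 1)).
move=> /compact_bounded[C [_ GC]].
have CC : C < `|C| + 1 by rewrite ltr_pwDr// ler_norm.
exists (`|C| + 1) => x Ax; apply: GC CC _ _; exists x => //=.
by apply: AM Ax; rewrite ltr_pwDr// ler_norm.
Qed.

(** * Weak gradients of truncated functions with continuous partial derivatives *)

Section classical_weak.
Context (R : realType) (n : nat) (Omega G : set 'rV[R]_n).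
Context (phi : 'rV[R]_n -> R) (dphi : 'I_n -> 'rV[R]_n -> R).
Hypotheses (oOmega : open Omega) (bOmega : bounded_set Omega).
Hypotheses (oG : open G) (GO : G `<=` Omega).
Hypotheses (cphi : continuous phi) (cdphi : forall i, continuous (dphi i)).
Hypothesis dphiP : forall i y, is_derive y (unit_vector R i) phi (dphi i y).
(* [phi] vanishes on [G] near the part of the boundary of [G] inside [Omega] *)
Hypothesis phi0 : forall y, Omega y -> ~ G y ->
  \forall z \near y, G z -> phi z = 0.

Lemma dphi0 i y : Omega y -> ~ G y -> \forall z \near y, G z -> dphi i z = 0.
Proof.
move=> Oy Gy; have := near_join (phi0 y Oy Gy); apply: filterS => z H Gz.
have <- : 'D_(unit_vector R i) phi z = dphi i z by apply: derive_val.
rewrite (@near_eq_derive _ _ _ phi (cst 0)) ?derive_cst//.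
near=> w; have := near H w; apply; first by [].
by near: w; exact: open_nbhs_nbhs.
Unshelve. all: by end_near. Qed.

Lemma measurable_restr_dphi i : measurable_fun setT (dphi i \_ G).
Proof.
apply/(measurable_restrictT _ (open_measurable_rV _ _ _ oG)).
by apply: measurable_funTS; exact: continuous_measurable_rV.
Qed.

Lemma restr_bounded (f : 'rV[R]_n -> R) : continuous f ->
  exists2 C : R, 0 <= C & forall x, `|(f \_ G) x| <= C.
Proof.
move=> /(continuous_bounded_on _ _ _ _ bOmega)[C fC]; exists `|C| => // x.
have [Gx|Gx] := pselect (G x); last by rewrite restrF// normr0.
by rewrite restrT// (le_trans (fC _ (GO _ Gx)))// ler_norm.
Qed.

(** Integration by parts. For a test function [psi], the product [phi * psi] cut off to [G] has a
    continuous partial derivative and bounded support in the whole space, so the integral of that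
    derivative is zero; the product rule splits it into the two integrals. *)
Lemma weak_partial_restr i : weak_partial Omega (phi \_ G) i (dphi i \_ G).
Proof.
split=> [K cK KO|psi [Cpsi cpsi spsi]].
  have mK : measurable K.
    by apply: closed_measurable_rV; apply: compact_closed => //; exact: norm_hausdorff.
  apply: measurable_bounded_integrable => //.
  - by apply: lebesgue_rV_bounded => //; exact: compact_bounded.
  - by apply: measurable_funTS; exact: measurable_restr_dphi.
  - have [C C0 HC] := restr_bounded _ (cdphi i).
    exists C; split; first exact: num_real.
    by move=> D CD y _ /=; apply: le_trans (HC y) (ltW CD).
set S := closure [set x | psi x != 0] in cpsi spsi.
set dpsi := 'D_(unit_vector R i) psi.
have cpsi0 : continuous psi by exact: (Cpsi 0%N).
have cdpsi : continuous dpsi by have [_] := Cpsi 1%N i.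
have dpsiP y : is_derive y (unit_vector R i) psi (dpsi y).
  by apply: derivableP; have [] := Cpsi 1%N i.
have psi0 y : ~ S y -> \forall z \near y, psi z = 0.
  move=> Sy; have : open (~` S) by apply: closed_openC; exact: closed_closure.
  move=> oS; have := open_nbhs_nbhs (conj oS Sy); apply: filterS => z Sz.
  by apply/eqP/negPn/negP => z0; apply: Sz; exact: subset_closure.
have dpsi0 y : ~ S y -> \forall z \near y, dpsi z = 0.
  by move=> /psi0; exact: is_derive_near0.
have [M SM] : exists M : R, forall y, ~ ball 0 M y -> ~ S y.
  have [M [_ H]] := compact_bounded cpsi; exists (`|M| + 2) => y yM Sy; apply: yM.
  rewrite -ball_normE /ball_/= sub0r normrN (@le_lt_trans _ _ (`|M| + 1))//.
    by apply: H Sy; rewrite ltr_pwDr// ler_norm.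
  by rewrite ltrD2l ltr1n.
(* Outside [G] there are two reasons for the product to vanish nearby: inside [Omega] the first
   factor does, and outside [Omega] the second does, its support being contained in [Omega]. *)
have near0 (f h : 'rV[R]_n -> R) :
    (forall y, Omega y -> ~ G y -> \forall z \near y, G z -> f z = 0) ->
    (forall y, ~ S y -> \forall z \near y, h z = 0) ->
    forall y, ~ G y -> \forall z \near y, G z -> f z * h z = 0.
  move=> f0 h0 y Gy; have [Oy|Oy] := pselect (Omega y).
    by apply: filterS (f0 y Oy Gy) => z H /H ->; rewrite mul0r.
  have /h0 : ~ S y by move=> /spsi.
  by apply: filterS => z -> _; rewrite mulr0.
have cont (f h : 'rV[R]_n -> R) : continuous f -> continuous h ->
    (forall y, Omega y -> ~ G y -> \forall z \near y, G z -> f z = 0) ->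
    (forall y, ~ S y -> \forall z \near y, h z = 0) ->
    continuous ((fun z => f z * h z) \_ G).
  move=> cf ch f0 h0 y; apply: continuous_at_restr => //; last exact: near0.
  by apply: continuousM; [exact: cf|exact: ch].
have supp (f h : 'rV[R]_n -> R) : (forall y, ~ S y -> \forall z \near y, h z = 0) ->
    forall y, ~ ball 0 M y -> ((fun z => f z * h z) \_ G) y = 0.
  move=> h0 y /SM/h0/nbhs_singleton hy.
  have [Gy|Gy] := pselect (G y); last exact: restrF.
  by rewrite restrT// hy mulr0.
have c1 := cont _ _ (cdphi i) cpsi0 (dphi0 i) psi0.
have c2 := cont _ _ cphi cdpsi phi0 dpsi0.
have i1 := integrable_continuous_support _ _ _ _ c1 (supp (dphi i) _ psi0).
have i2 := integrable_continuous_support _ _ _ _ c2 (supp phi _ dpsi0).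
have restrM (f h : 'rV[R]_n -> R) :
    (fun z => (f \_ G) z * h z) \_ Omega = (fun z => f z * h z) \_ G.
  apply/funext => y; have [Gy|Gy] := pselect (G y).
    by rewrite !restrT//; exact: GO.
  rewrite [RHS]restrF//; have [Oy|Oy] := pselect (Omega y); last by rewrite restrF.
  by rewrite restrT// restrF// mul0r.
rewrite Rintegral_mkcond [in RHS]Rintegral_mkcond !restrM.
apply/eqP; rewrite -addr_eq0 addrC -RintegralD//; apply/eqP.
rewrite /Rintegral.
suff -> : (\int[lebesgue_rV R n]_y (((fun z => dphi i z * psi z) \_ G) y +
  ((fun z => phi z * dpsi z) \_ G) y)%:E = 0)%E by [].
apply: (@integral_partial_support R n ((fun z => phi z * psi z) \_ G)
  (fun y => ((fun z => dphi i z * psi z) \_ G) y +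
            ((fun z => phi z * dpsi z) \_ G) y) i M).
- move=> y.
  have := @is_derive_restr _ _ _ oG _ (fun z => dphi i z * psi z + phi z * dpsi z)
    (unit_vector R i) y _ (near0 _ _ phi0 psi0 y).
  have H : is_derive y (unit_vector R i) (fun z => phi z * psi z)
      (dphi i y * psi y + phi y * dpsi y).
    apply: is_derive_eq (is_deriveM (dphiP i y) (dpsiP y)) _.
    by rewrite addrC mulrC.
  move=> /(_ H) /is_derive_eq; apply.
  have [Gy|Gy] := pselect (G y); first by rewrite !restrT.
  by rewrite !restrF// addr0.
- by move=> y; apply: continuousD; [exact: c1|exact: c2].
- by move=> y yM; rewrite !supp// addr0.
Qed.

Lemma royden_algebra_restr (n0 : (0 < n)%N) :
  royden_algebra Omega (fun z : Omega => (phi \_ G) (set_val z)).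
Proof.
split.
- move=> z; apply: (@continuous_comp _ _ _ set_val (phi \_ G)).
    exact: initial_continuous.
  apply: continuous_at_restr => // Gz.
  by apply: phi0 Gz; exact: set_valP.
- by have [C _ HC] := restr_bounded _ cphi; exists C => x; exact: HC.
- pose g y : 'rV[R]_n := \row_i (dphi i \_ G) y.
  have gE i : (fun y => g y ord0 i) = dphi i \_ G by apply/funext => y; rewrite mxE.
  exists g => i; rewrite gE.
  + rewrite valL0E (_ : _ \_ Omega = phi \_ G); first exact: weak_partial_restr.
    apply/funext => y; have [Oy|Oy] := pselect (Omega y); first by rewrite restrT.
    by rewrite !restrF// => /GO.
  + have [C _ HC] := restr_bounded _ (cdphi i).
    apply: (@in_Lp_bounded _ _ _ _ _ C) => //; first exact: open_measurable_rV.
    exact: measurable_restr_dphi.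
Qed.

End classical_weak.

(** If [|u x|] exceeded an essential bound [c], continuity would make [|u| > c] on a nonempty open
    subset of [Omega], which has positive measure. *)
Lemma le_Lnorm_infty_continuous (R : realType) n (Omega : set 'rV[R]_n)
    (u : Omega -> R) (x : Omega) : open Omega -> continuous u ->
  (`|u x|%:E <= Lnorm_on Omega +oo ('valL_0%R u))%E.
Proof.
move=> oO cu.
have O0 : Omega !=set0 by exists (set_val x); exact: set_valP.
(* The norm with exponent [+oo] unfolds to the essential supremum only when the whole space has
   positive measure. *)
have mu0 : (0 < lebesgue_rV R n setT)%E.
  by apply: lebesgue_rV_open_gt0; [exact: openT|exists 0].
rewrite /Lnorm_on unlock mu0 /ess_sup; apply: le_ereal_inf_tmp => c /= [N [mN N0 HN]].
rewrite leNgt; apply/negP => cu'.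
have oW : open [set z : Omega | (c < `|u z|%:E)%E].
  case: c cu' {HN} => [r| |] cu'.
  - rewrite (_ : mkset _ = (fun z => `|u z|) @^-1` [set t | r < t]); last first.
      by apply/seteqP; split=> z /=; rewrite lte_fin.
    apply: open_comp; last exact: open_gt.
    by move=> z _; apply: continuous_comp; [exact: cu|exact: norm_continuous].
  - by rewrite ltNge leey in cu'.
  - rewrite (_ : mkset _ = setT); first exact: openT.
    by apply/seteqP; split=> z //= _; rewrite ltNyr.
have [W oWW WE] := oW.
have WON : W `&` Omega `<=` N.
  move=> z [Wz Oz]; apply: HN => /=.
  pose z' : Omega := SigSub (mem_set Oz).
  have : [set z : Omega | (c < `|u z|%:E)%E] z' by rewrite -WE.
  rewrite /mkset.
  have -> : u z' = ('valL_0%R u \_ Omega) z.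
    by rewrite restrT//; exact/esym/(congr1 (fun h => h z') (valLK (0:R) u)).
  by move=> /= + H2; rewrite ltNge H2.
have : (0 < lebesgue_rV R n (W `&` Omega))%E.
  apply: lebesgue_rV_open_gt0; first exact: openI.
  exists (set_val x); split; last exact: set_valP.
  by have : [set z : Omega | (c < `|u z|%:E)%E] x by []; rewrite -WE.
rewrite ltNge => /negP; apply; rewrite -N0; apply: le_measure; rewrite ?inE//.
by apply: open_measurable_rV; exact: openI.
Qed.

(** * A continuously differentiable bump function *)

Definition posq (R : realType) (t : R) : R := Num.max 0 t ^+ 2.

Lemma is_derive_posq (R : realType) (t : R) :
  is_derive t 1 (@posq R) (2 * Num.max 0 t).
Proof.
have [t0|t0|->] := ltgtP t 0.
- rewrite mulr0; apply: (@near_eq_is_derive _ _ _ (cst 0)).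
    by apply: filterS (lt_nbhsl t0) => s s0; rewrite /posq max_l ?expr0n// ltW.
- apply: (@near_eq_is_derive _ _ _ ((@id R) ^+ 2)).
    by apply: filterS (lt_nbhsr t0) => s s0; rewrite /posq max_r// ltW.
  by apply: is_derive_eq; rewrite -mulr_natl /= expr1 scaler1.
- rewrite mulr0.
  (* At the origin the difference quotient is [h] for positive [h] and [0] for negative [h]. *)
  have H : h^-1 *: ((@posq R \o shift 0) (h *: (1 : R^o)) - posq R 0)
      @[h --> 0^'] --> (0 : R).
    apply/cvgr0Pnorm_le => e e0; near=> h.
    have h0 : h != 0 by near: h; exact: nbhs_dnbhs_neq.
    have he : `|h| <= e by near: h; apply: dnbhs0_le.
    rewrite /= addr0 {2}/posq maxxx expr0n subr0 /posq [h *: _]mulr1.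
    have [h1|h1] := leP 0 h; last by rewrite expr0n scaler0 normr0 ltW.
    by rewrite /GRing.scale /= expr2 mulKf.
  by split; [apply: cvgP H|apply: cvg_lim H].
Unshelve. all: by end_near. Qed.

Section bump.
Context (R : realType) (n : nat) (x : 'rV[R]_n) (rho : R).

Definition bump_arg (y : 'rV[R]_n) : R :=
  rho ^+ 2 - \sum_j (y ord0 j - x ord0 j) ^+ 2.
Definition bumpf y := posq R (bump_arg y).
Definition dbumpf i (y : 'rV[R]_n) :=
  - 4 * (y ord0 i - x ord0 i) * Num.max 0 (bump_arg y).

Lemma continuous_bump_arg : continuous bump_arg.
Proof.
have csum : continuous (fun y : 'rV[R]_n => \sum_j (y ord0 j - x ord0 j) ^+ 2).
  apply: (@continuous_big R _ +%R 0 _ _ _ _ (fun j (y : 'rV[R]_n) =>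
    (y ord0 j - x ord0 j) ^+ 2)) => [|j _ y]; first exact: add_continuous.
  apply: (@continuous_comp _ _ _ (fun y : 'rV[R]_n => y ord0 j - x ord0 j)
    (fun t : R => t ^+ 2)); last exact: exprn_continuous.
  apply: continuousB; first exact: coord_continuous.
  exact: cst_continuous.
move=> y; apply: (@continuousB _ _ _ (cst (rho ^+ 2)) (fun y : 'rV[R]_n =>
  \sum_j (y ord0 j - x ord0 j) ^+ 2)); [exact: cst_continuous|exact: csum].
Qed.

Lemma continuous_max0 (f : 'rV[R]_n -> R) : continuous f ->
  continuous (fun y => Num.max 0 (f y)).
Proof.
by move=> cf y; apply: continuous_max; [exact: cst_continuous|exact: cf].
Qed.

Lemma continuous_bump : continuous bumpf.
Proof.
move=> y; apply: (@continuous_comp _ _ _ (fun y => Num.max 0 (bump_arg y))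
  (fun t : R => t ^+ 2)); last exact: exprn_continuous.
by apply: continuous_max0; exact: continuous_bump_arg.
Qed.

Lemma continuous_dbump i : continuous (dbumpf i).
Proof.
move=> y; apply: (@continuousM _ _ (fun y : 'rV[R]_n => - 4 * (y ord0 i - x ord0 i))
  (fun y => Num.max 0 (bump_arg y))); last first.
  by apply: continuous_max0; exact: continuous_bump_arg.
apply: (@continuousM _ _ (cst (- 4)) (fun y : 'rV[R]_n => y ord0 i - x ord0 i)).
  exact: cst_continuous.
by apply: continuousB; [exact: coord_continuous|exact: cst_continuous].
Qed.

(** Along the line through [y] in direction [i], [bump_arg] is the quadratic polynomial [q], which
    reduces the claim to the one-variable chain rule. *)
Lemma is_derive_bump i y : is_derive y (unit_vector R i) bumpf (dbumpf i y).
Proof.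
pose q (h : R) := bump_arg y - 2 * (y ord0 i - x ord0 i) * h - h ^+ 2.
apply: (@is_derive_shift_eq _ _ _ _ (@posq R \o q) _ _ (0 : R^o) 1) => [h|].
  have -> : h *: (1 : R^o) + 0 = h by rewrite addr0 [LHS]mulr1.
  rewrite /bumpf /=; congr posq; rewrite /q /bump_arg.
  rewrite (bigD1 i)//= [in RHS](bigD1 i)//= !mxE eqxx/=.
  under eq_bigr => j ji do rewrite !mxE (negbTE ji) andbF mulr0 add0r.
  rewrite eqxx mulr1; move: (\sum_(_ < _ | _) _) => S; move: (y _ _) (x _ _) => a b; ring.
have dq : is_derive (0 : R) 1 q (- 2 * (y ord0 i - x ord0 i)).
  rewrite /q; apply: is_derive_eq; rewrite !scale0r !addr0 subr0 add0r mul1r [_%:A]mulr1.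
  by rewrite mulNr.
apply: is_derive_eq (is_derive1_comp (is_derive_posq _ _) dq) _.
by rewrite /q mulr0 expr0n /= !subr0 /dbumpf; ring.
Qed.
End bump.

(** * Nested compact connected sets *)

Lemma nested_le (T : Type) (E : nat -> set T) (i j : nat) :
  (forall k, E k.+1 `<=` E k) -> (i <= j)%N -> E j `<=` E i.
Proof.
by move=> dE /subnK <-; elim: (j - i)%N => [|m ih]//= z /dE/ih.
Qed.

(** Otherwise the sets [K k] minus [U] generate a proper filter. A cluster point of it lies in every
    [K k] but not in [U]. *)
Lemma compact_nested_sub (T : topologicalType) (K : nat -> set T) (U : set T) :
  compact (K 0%N) -> (forall k, closed (K k)) ->
  (forall k, K k.+1 `<=` K k) -> open U -> \bigcap_k K k `<=` U ->
  exists k, K k `<=` U.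
Proof.
move=> cK clK decK oU KU; apply: contrapT => /forallNP H.
have mono i j : (i <= j)%N -> K j `<=` K i by exact: nested_le.
pose F : set_system T := [set B | exists k, K k `\` U `<=` B].
have FF : ProperFilter F.
  apply: Build_ProperFilter_ex.
    move=> B [k kB]; have /existsNP[z /not_implyP[Kz Uz]] := H k.
    by exists z; exact: kB.
  split; first by exists 0%N.
  - move=> A B [k kA] [l lB]; exists (maxn k l) => z [Kz Uz]; split.
      by apply: kA; split=> //; apply: mono Kz; exact: leq_maxl.
    by apply: lB; split=> //; apply: mono Kz; exact: leq_maxr.
  - by move=> A B AB [k kA]; exists k => z /kA/AB.
have [p [_ pF]] : K 0%N `&` cluster F !=set0 by apply: cK; exists 0%N => z [].
have pKU k : (K k `\` U) p.
  have : closed (K k `\` U) by apply: closedI => //; exact: open_closedC.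
  move=> /closure_id ->; move=> V Vp; apply: pF => //; exact: (ex_intro _ k).
by have [_] := pKU 0%N; apply; apply: KU => k _; case: (pKU k).
Qed.

Lemma connected_sub_open (T : topologicalType) (C A B : set T) :
  connected C -> open A -> open B -> C `<=` A `|` B ->
  C `&` A `&` B = set0 -> C `&` A !=set0 -> C `<=` A.
Proof.
move=> cC oA oB CAB CAB0 CA0.
suff <- : C `&` A = C by move=> z [].
apply: cC => //; first by exists A.
exists (~` B); first exact: open_closedC.
apply/seteqP; split=> z [Cz Hz]; split=> //.
- by move=> Bz; rewrite -[False]/(@set0 T z) -CAB0.
- by case: (CAB _ Cz).
Qed.

(** Otherwise the traces on [B] of the closures of neighbourhoods of [S] form a filter base. At a
    cluster point [p] in [B], the open [V] given by the separation hypothesis would meet some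
    closure of [W], hence [W] itself. *)
Lemma compact_set_nbhs_sep (T : topologicalType) (S B : set T) : compact B ->
  (forall p, B p -> exists2 V, open_nbhs p V &
    exists2 W, set_nbhs S W & V `&` W = set0) ->
  exists2 W, set_nbhs S W & B `&` closure W = set0.
Proof.
move=> cB sep; apply: contrapT => nW.
have BW W : set_nbhs S W -> B `&` closure W !=set0.
  by move=> SW; apply/set0P/negP => /eqP BW; apply: nW; exists W.
pose F := filter_from (set_nbhs S) (fun W => B `&` closure W).
have FF : ProperFilter F.
  apply: filter_from_proper; last exact: BW.
  apply: filter_from_filter; first by exists setT;
    exact: (@filterT _ _ (set_nbhs_filter S)).
  move=> W1 W2 S1 S2; exists (W1 `&` W2); first exact: (@filterI _ _ (set_nbhs_filter S)).
  by move=> z [Bz] /closureI[z1 z2].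
have [p [Bp pF]] : B `&` cluster F !=set0.
  by apply: cB; exists setT => [|z []//]; exact: (@filterT _ _ (set_nbhs_filter S)).
have [V oV [W SW VW]] := sep p Bp.
have [||q [[_ qW] Vq]] := pF (B `&` closure W) V; first by exists W.
  exact: open_nbhs_nbhs.
have [|t [Wt Vt]] := qW V; first by apply: open_nbhs_nbhs; split=> //; case: oV.
by rewrite -[False]/(@set0 T t) -VW.
Qed.

(** The previous lemma is applied twice: first to separate each point of [A] from [B], then to
    separate [A] from [B]. *)
Lemma compact_disjoint_sep (T : topologicalType) (A B : set T) :
  hausdorff_space T -> compact A -> compact B -> A `&` B = set0 ->
  exists V W, [/\ open V, open W, A `<=` V, B `<=` W & V `&` W = set0].
Proof.
move=> hT cA cB AB.
have [W BW AW] : exists2 W, set_nbhs B W & A `&` closure W = set0.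
  apply: compact_set_nbhs_sep cA _ => p Ap.
  have [V pV BV] : exists2 V, set_nbhs [set p] V & B `&` closure V = set0.
    apply: compact_set_nbhs_sep cB _ => q Bq.
    have pq : p != q.
      apply/eqP => pq; rewrite -[False]/(@set0 T p) -AB; split=> //.
      by rewrite pq.
    move: hT; rewrite open_hausdorff => /(_ p q pq)[[V W] /= [Vp Wq] [oV oW VW]].
    exists W; first by split=> //; by move: Wq; rewrite inE.
    exists V; last by rewrite setIC; exact/eqP.
    apply/set_nbhsP; exists V; split=> // z ->; by move: Vp; rewrite inE.
  have /set_nbhsP[V' [oV' pV' V'V]] := pV.
  exists V'; first by split=> //; exact: pV'.
  exists (~` closure V').
    apply/set_nbhsP; exists (~` closure V'); split=> //.
      by apply: closed_openC; exact: closed_closure.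
    move=> z Bz Vz; rewrite -[False]/(@set0 T z) -BV; split=> //.
    exact: closureS Vz.
  by apply/disjoints_subset; rewrite setCK; exact: subset_closure.
have /set_nbhsP[W' [oW' BW' W'W]] := BW.
exists (~` closure W'), W'; split=> //.
- by apply: closed_openC; exact: closed_closure.
- move=> z Az Wz; rewrite -[False]/(@set0 T z) -AW; split=> //.
  exact: closureS Wz.
- by rewrite setIC; apply/disjoints_subset; rewrite setCK; exact: subset_closure.
Qed.

(** A clopen part [B] of the intersection and its complement [B'] there are disjoint compact sets,
    so they have disjoint open neighbourhoods [V] and [W]. Some [K k] lies in their union, and by
    connectedness in [V], which leaves nothing for [B']. *)
Lemma connected_nested (T : topologicalType) (K : nat -> set T) :
  hausdorff_space T -> compact (K 0%N) -> (forall k, closed (K k)) ->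
  (forall k, K k.+1 `<=` K k) -> (forall k, connected (K k)) ->
  connected (\bigcap_k K k).
Proof.
move=> hT cK clK decK conK B B0 [U oU BU] [D cD BD].
have clB : closed B.
  by rewrite BD; apply: closedI => //; apply: closed_bigI => k _; exact: clK.
pose L := \bigcap_k K k; rewrite -/L.
have clL : closed L by apply: closed_bigI => k _; exact: clK.
pose B' := L `\` U.
have clB' : closed B' by apply: closedI => //; exact: open_closedC.
have BK : B `<=` K 0%N by rewrite BU => z [Lz _]; exact: Lz.
have cB : compact B by exact: subclosed_compact clB cK BK.
have cB' : compact B' by apply: subclosed_compact clB' cK _ => z [Lz _]; exact: Lz.
have [V [W [oV oW BV B'W VW]]] : exists V W,
    [/\ open V, open W, B `<=` V, B' `<=` W & V `&` W = set0].
  apply: compact_disjoint_sep => //; apply/seteqP; split=> // z [].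
  by rewrite BU => -[_ Uz] [_].
have [k kVW] : exists k, K k `<=` V `|` W.
  apply: compact_nested_sub => //; first exact: openU.
  move=> z Lz; have [Uz|Uz] := pselect (U z); first by left; apply: BV; rewrite BU.
  by right; exact: B'W.
have KV : K k `<=` V.
  apply: (connected_sub_open _ _ _ _ (conK k) oV oW kVW).
    by rewrite -setIA VW setI0.
  have [z Bz] := B0; exists z; split; [by move: Bz; rewrite BU => -[Lz _]; exact: Lz|exact: BV].
rewrite BU; apply/seteqP; split=> z; first by case.
move=> Lz; split=> //; apply: contrapT => Uz.
have : (V `&` W) z by split; [apply: KV; exact: Lz|apply: B'W].
by rewrite VW.
Qed.
Lemma nested_nonempty (T : topologicalType) (K : nat -> set T) :
  compact (K 0%N) -> (forall k, closed (K k)) ->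
  (forall k, K k.+1 `<=` K k) -> (forall k, K k !=set0) ->
  \bigcap_k K k !=set0.
Proof.
move=> cK clK decK K0; apply/set0P/negP => /eqP KE.
have [|k] := compact_nested_sub _ K set0 cK clK decK open0; first by rewrite KE.
by have [z Kz] := K0 k => /(_ _ Kz).
Qed.

(** Without a boundary point of [E], the set [C] would be covered by the disjoint open sets interior
    of [E] and complement of its closure. *)
Lemma connected_meets_boundary (R : realType) n (C E : set 'rV[R]_n) :
  connected C -> C `&` E !=set0 -> ~ C `<=` E -> C `&` boundary E !=set0.
Proof.
move=> cC [z [Cz Ez]] CE; apply/set0P/negP => /eqP bE; apply: CE.
have noB w : C w -> closure E w -> E° w.
  move=> Cw Ew; apply: contrapT => Iw.
  by rewrite -[False]/(@set0 'rV[R]_n w) -bE.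
apply: subset_trans (@interior_subset _ E).
apply: (connected_sub_open _ _ _ (~` closure E)) => //.
- exact: open_interior.
- by apply: closed_openC; exact: closed_closure.
- by move=> w Cw; have [Ew|Ew] := pselect (closure E w); [left; exact: noB|right].
- apply/seteqP; split=> // w [[_ /interior_subset Ew]]; apply.
  exact: subset_closure.
- by exists z; split=> //; apply: noB => //; exact: subset_closure.
Qed.

(** * Components of open sets *)

Lemma connected_ball (R : realType) n (x : 'rV[R]_n) e : 0 < e ->
  connected (ball x e).
Proof.
move=> e0.
pose seg (y : 'rV[R]_n) := [set t *: (y - x) + x | t in `[0 : R, 1]].
have xy y : seg y x by exists 0; rewrite /= ?in_itv/= ?lexx ?ler01// scale0r add0r.
have -> : ball x e = \bigcup_(y in ball x e) seg y.
  apply/seteqP; split=> [y yx|z [y + [t]]].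
    by exists y => //; exists 1; rewrite /= ?in_itv/= ?lexx ?ler01// scale1r subrK.
  rewrite -!ball_normE /ball_/= in_itv/= => xy1 /andP[t0 t1] <-.
  rewrite opprD addrCA subrr addr0 normrN normrZ ger0_norm//.
  by rewrite (le_lt_trans _ xy1)// distrC ler_piMl.
apply: bigcup_connected; first by exists x => y _; exact: xy.
move=> y _; apply: connected_continuous_connected; first exact: segment_connected.
apply: continuous_subspaceT => t.
apply: (@continuousD _ _ _ (fun t : R => t *: (y - x)) (cst x)).
  exact: scalel_continuous.
exact: cst_continuous.
Qed.

Lemma component_open (R : realType) n (U : set 'rV[R]_n) x :
  open U -> open (connected_component U x).
Proof.
move=> oU; rewrite openE => y Cy; have Uy := connected_component_sub Cy.
have [e /= e0 eU] : nbhs_ball y U by apply/nbhs_ballP; exact: open_nbhs_nbhs.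
apply/nbhs_ballP; exists e => //= z ze; rewrite (same_connected_component Cy).
apply: (connected_component_max _ eU) => //; first exact: ballxx.
exact: connected_ball.
Qed.

Section components.
Context (R : realType) (n : nat) (U : set 'rV[R]_n).
Hypothesis oU : open U.
Implicit Types C D : set 'rV[R]_n.

Lemma components_open C : components U C -> open C.
Proof. by move=> [z _ <-]; exact: component_open. Qed.

Lemma components_sub C : components U C -> C `<=` U.
Proof. by move=> [z _ <-]; exact: connected_component_sub. Qed.

Lemma components_connected C : components U C -> connected C.
Proof. by move=> [z _ <-]; exact: component_connected. Qed.

Lemma components_nonempty C : components U C -> C !=set0.
Proof. by move=> [z Uz <-]; exists z; exact: connected_component_refl. Qed.

Lemma components_max C D : components U C -> connected D -> D `<=` U ->
  C `&` D !=set0 -> D `<=` C.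
Proof.
move=> [z Uz <-] cD DU [w [Cw Dw]]; rewrite (same_connected_component Cw).
exact: connected_component_max.
Qed.

Lemma components_eq C D : components U C -> components U D ->
  C `&` D !=set0 -> C = D.
Proof.
move=> UC UD CD; apply/seteqP; split.
  apply: (components_max _ _ UD (components_connected _ UC) (components_sub _ UC)).
  by rewrite setIC.
exact: components_max UC (components_connected _ UD) (components_sub _ UD) CD.
Qed.

(** The component of [y] is an open neighbourhood of [y] disjoint from [C]. *)
Lemma components_closed_in C y : components U C -> U y -> ~ C y ->
  \forall z \near y, ~ C z.
Proof.
move=> UC Uy Cy.
have UD : components U (connected_component U y) by exists y.
have Dy : connected_component U y y by exact: connected_component_refl.
have := open_nbhs_nbhs (conj (components_open _ UD) Dy).
apply: filterS => z Dz Cz; apply: Cy.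
by rewrite (components_eq _ _ UC UD)//; exists z.
Qed.

End components.

(** * Ends and branches *)

Lemma mx_norm_coord (R : realType) n (v : 'rV[R]_n) i : `|v ord0 i| <= `|v|.
Proof.
rewrite leNgt; apply/negP => vi.
have : ball (0 : 'rV[R]_n) `|v ord0 i| v by rewrite -ball_normE /ball_/= sub0r normrN.
rewrite ball_rVE ?(le_lt_trans _ vi)// => /(_ i).
by rewrite mxE /ball /= sub0r normrN ltxx.
Qed.

Lemma enorm_ge_norm (R : realType) n (v : 'rV[R]_n) : `|v| <= enorm v.
Proof.
rewrite leNgt; apply/negP => ev.
have e0 : 0 < `|v| by rewrite (le_lt_trans _ ev)// sqrtr_ge0.
suff : ball (0 : 'rV[R]_n) `|v| v by rewrite -ball_normE /ball_/= sub0r normrN ltxx.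
rewrite ball_rVE// => i; rewrite mxE /ball /= sub0r normrN.
apply: le_lt_trans ev; rewrite /enorm -sqrtr_sqr ler_wsqrtr// (bigD1 i)//= lerDl.
by apply: sumr_ge0 => j _; exact: sqr_ge0.
Qed.

Lemma enorm_le_norm (R : realType) n (v : 'rV[R]_n) : enorm v <= n%:R * `|v|.
Proof.
rewrite /enorm -[leRHS]ger0_norm ?mulr_ge0// -sqrtr_sqr ler_wsqrtr// exprMn.
apply: (@le_trans _ _ (n%:R * `|v| ^+ 2)).
  rewrite mulr_natl; have <- : \sum_(i < n) `|v| ^+ 2 = `|v| ^+ 2 *+ n.
    by rewrite sumr_const card_ord.
  apply: ler_sum => i _; rewrite -real_normK ?num_real//.
  by rewrite lerXn2r ?nnegrE// mx_norm_coord.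
(* The sharp constant is the square root of [n]; the cruder [n] follows from [n <= n ^ 2]. *)
by rewrite ler_wpM2r ?sqr_ge0// -natrX ler_nat; case: n v => // n _; rewrite leq_pmulr.
Qed.

Lemma diam_ball (R : realType) n (x : 'rV[R]_n) r (A : set 'rV[R]_n) :
  A `<=` ball x r -> (diam A <= (n%:R * (r + r))%:E)%E.
Proof.
move=> Ar; apply: ge_ereal_sup => _ [y Ay [z Az <-]]; rewrite lee_fin.
apply: (le_trans (enorm_le_norm _ _ _)); rewrite ler_wpM2l// ltW//.
have := ball_triangle (ball_sym (Ar _ Ay)) (Ar _ Az).
by rewrite -ball_normE.
Qed.

(** Any connected set through both points has at least their distance as diameter. This bounds
    Mazurkiewicz distances from below without looking at connected sets again. *)
Lemma mazurkiewicz_ge (R : realType) n (Omega : set 'rV[R]_n) y z :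
  (`|y - z|%:E <= mazurkiewicz Omega y z)%E.
Proof.
apply: le_ereal_inf_tmp => _ [K [_ _ Ky Kz] <-].
apply: (@le_trans _ _ (enorm (y - z))%:E); first by rewrite lee_fin enorm_ge_norm.
by apply: ereal_sup_ubound; exists y => //; exists z.
Qed.

Lemma acceptable_nonempty (R : realType) n (Omega E : set 'rV[R]_n) :
  acceptable Omega E -> E !=set0.
Proof.
by move=> [_ _ _ [w [cw _]]]; have [z [Ez _]] := cw setT filterT; exists z.
Qed.

Lemma chain_impression_divides (R : realType) n (E F : nat -> set 'rV[R]_n) :
  divides E F -> chain_impression E `<=` chain_impression F.
Proof.
move=> EF z Ez k _; have [l /(_ l (leqnn l)) lk] := EF k.
by apply: closureS lk _ _; exact: Ez.
Qed.

Lemma divides_refl (R : realType) n (E : nat -> set 'rV[R]_n) :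
  (forall k, E k.+1 `<=` E k) -> divides E E.
Proof. by move=> dE k; exists k => l kl; exact: nested_le. Qed.

Lemma divides_trans (R : realType) n (E F G : nat -> set 'rV[R]_n) :
  divides E F -> divides F G -> divides E G.
Proof.
move=> EF FG k; have [l lk] := FG k; have [m ml] := EF l.
by exists m => j mj; exact: subset_trans (ml j mj) (lk l (leqnn l)).
Qed.

Section branches.
Context (R : realType) (n : nat) (Omega : set 'rV[R]_n) (x : 'rV[R]_n) (r0 : R).
Hypotheses (oOmega : open Omega) (bOmega : bounded_set Omega).
Hypotheses (hx : boundary Omega x) (r0_gt0 : 0 < r0).
Hypothesis Omega_out : ~ Omega `<=` ball x r0.

Definition radius_seq k : R := r0 / k.+1%:R.
(** The ball is one of the sup norm, hence a cube; these cubes form a neighbourhood base at [x]. *)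
Definition nbhd k := Omega `&` ball x (radius_seq k).

Definition branch : set (nat -> set 'rV[R]_n) :=
  [set b | forall k, components (nbhd k) (b k) /\ b k.+1 `<=` b k].

Lemma radius_gt0 k : 0 < radius_seq k. Proof. by rewrite divr_gt0. Qed.

Lemma radius_lt k : radius_seq k.+1 < radius_seq k.
Proof. by rewrite ltr_pM2l// ltf_pV2 ?posrE// ltr_nat. Qed.

Lemma radius_le k : radius_seq k <= r0.
Proof. by rewrite ler_piMr ?invf_le1 ?ler1n// ltW. Qed.

Lemma radius_small e : 0 < e -> exists k, radius_seq k < e.
Proof.
move=> e0; have [|k] := @ltr_add_invr R 0 (e / r0); first by rewrite divr_gt0.
by rewrite add0r ltr_pdivlMr// => H; exists k; rewrite /radius_seq mulrC.
Qed.

Lemma nbhd_open k : open (nbhd k).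
Proof. by apply: openI => //; exact: ball_open. Qed.

Lemma nbhd_sub k : nbhd k.+1 `<=` nbhd k.
Proof.
by move=> z [Oz zx]; split=> //; apply: le_ball zx; rewrite ltW// radius_lt.
Qed.

Lemma x_notin : ~ Omega x.
Proof. by case: hx => _ ix Ox; apply: ix; move: oOmega; rewrite openE; exact. Qed.

Section one_branch.
Context (b : nat -> set 'rV[R]_n).
Hypothesis hb : branch b.

Lemma branch_component k : components (nbhd k) (b k). Proof. by case: (hb k). Qed.

Lemma branch_step k : b k.+1 `<=` b k. Proof. by case: (hb k). Qed.

Lemma branch_mono k l : (k <= l)%N -> b l `<=` b k.
Proof. exact: nested_le branch_step. Qed.

Lemma branch_sub k : b k `<=` Omega.
Proof. by move=> z /(components_sub _ _ _ _ (branch_component k))[]. Qed.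

Lemma branch_ball k : b k `<=` ball x (radius_seq k).
Proof. by move=> z /(components_sub _ _ _ _ (branch_component k))[]. Qed.

Lemma branch_open k : open (b k).
Proof. exact: components_open (nbhd_open k) _ (branch_component k). Qed.

Lemma branch_nonempty k : b k !=set0.
Proof. exact: components_nonempty (branch_component k). Qed.

Lemma branch_connected k : connected (b k).
Proof. exact: components_connected (branch_component k). Qed.

Lemma branch_closure k : closure (b k) x.
Proof.
move=> V /nbhs_ballP[e /= e0 eV]; have [l le] := radius_small e e0.
have [z bz] := branch_nonempty (maxn k l); exists z; split.
  exact: branch_mono (leq_maxl k l) _ bz.
apply: eV; apply: (le_ball (ltW le)); apply: branch_ball.
exact: branch_mono (leq_maxr k l) _ bz.
Qed.

Lemma branch_impression : chain_impression b = [set x].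
Proof.
apply/seteqP; split=> [z bz|z -> k _]; last exact: branch_closure.
have hT : hausdorff_space 'rV[R]_n by exact: norm_hausdorff.
have -> // : z = x; apply: hT => V W Vz Wx.
have /nbhs_ballP[e /= e0 eW] := Wx; have [l le] := radius_small e e0.
have [w [bw Vw]] := bz l Logic.I V Vz; exists w; split=> //.
by apply: eW; apply: (le_ball (ltW le)); exact: branch_ball bw.
Qed.

(** Inside [nbhd k] the component [b k] is both open and relatively closed, so it has no boundary
    point there. *)
Lemma branch_boundary k : Omega `&` boundary (b k) `<=` ~` ball x (radius_seq k).
Proof.
move=> z [Oz [cz iz]] zx; apply: iz.
have Uz : nbhd k z by [].
have [bz|bz] := pselect (b k z).
  by have := branch_open k; rewrite openE; exact.
have := components_closed_in _ _ _ (nbhd_open k) _ z (branch_component k) Uz bz.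
by move=> /cz[w [? /= ]].
Qed.

Lemma branch_chain : chain Omega b.
Proof.
split.
- move=> k; split.
  + have [M [rM HM]] := bOmega; exists M; split=> // N MN z bz.
    by apply: HM MN _ _; exact: branch_sub bz.
  + exact: branch_connected.
  + split; first exact: branch_sub.
    (* An acceptable set is a proper subset of [Omega]; this is why the initial ball must not
       contain [Omega]. *)
    move=> Ob; apply: Omega_out => z Oz; apply: (le_ball (radius_le k)).
    by apply: branch_ball; exact: Ob.
  + by exists x; split=> //; exact: branch_closure.
- exact: branch_step.
(* Seen from [x], the boundary of [b k.+1] stays within [radius_seq k.+1], whereas the part in
   [Omega] of the boundary of [b k] stays at distance at least [radius_seq k]. *)
- move=> k; apply: (@lt_le_trans _ _ (radius_seq k - radius_seq k.+1)%:E).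
    by rewrite lte_fin subr_gt0 radius_lt.
  apply: le_ereal_inf_tmp => _ [y [Oy yb] [z [Oz zb] <-]].
  apply: le_trans (mazurkiewicz_ge _ _ _ y z); rewrite lee_fin.
  have zx : radius_seq k <= `|x - z|.
    rewrite leNgt; apply/negP => zx.
    by apply: (branch_boundary k z) => //; rewrite -ball_normE.
  have yx : `|x - y| <= radius_seq k.+1.
    rewrite leNgt; apply/negP => xy; have [yc _] := yb.
    have [|w [bw /= wy]] := yc (ball y (`|x - y| - radius_seq k.+1)).
      by apply: nbhsx_ballx; rewrite subr_gt0.
    have := branch_ball k.+1 w bw; move: wy; rewrite -!ball_normE /ball_/= => wy wx.
    have := ler_normD (x - w) (w - y); rewrite addrA subrK (distrC w y).
    by move: wx wy; lra.
  have := ler_normD (x - y) (y - z); rewrite addrA subrK => xyz.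
  by move: zx yx xyz; lra.
- by rewrite branch_impression => z ->.
Qed.

(** If [E m] contained no [b l], each [b l], which meets [E m.+1] because [E] divides [b], would
    cross the boundaries of both [E m.+1] and [E m]. Their Mazurkiewicz distance would be at most
    the diameter of [b l], which tends to zero. *)
Lemma branch_divides E : chain Omega E -> divides E b -> divides b E.
Proof.
move=> [aE dE ME iE] Eb m.
suff [l bl] : exists l, b l `<=` E m.
  by exists l => j lj; apply: subset_trans bl; exact: branch_mono.
apply: contrapT => /forallNP H; have := ME m; rewrite ltNge => /negP; apply.
have Emono i j : (i <= j)%N -> E j `<=` E i by exact: nested_le.
have small l : (mazurkiewicz_dist Omega (Omega `&` boundary (E m.+1))
    (Omega `&` boundary (E m)) <= (n%:R * (radius_seq l + radius_seq l))%:E)%E.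
  have [z [bz Ez]] : b l `&` E m.+1 !=set0.
    have [j /(_ (maxn j m.+1) (leq_maxl _ _)) jb] := Eb l.
    have [z Ez] := acceptable_nonempty _ _ _ _ (aE (maxn j m.+1)).
    by exists z; split; [exact: jb|exact: Emono (leq_maxr _ _) _ Ez].
  have [y [by1 yE]] : b l `&` boundary (E m.+1) !=set0.
    apply: connected_meets_boundary (branch_connected l) _ _; first by exists z.
    by move=> bE; apply: (H l); apply: subset_trans bE _; exact: dE.
  have [w [bw wE]] : b l `&` boundary (E m) !=set0.
    apply: connected_meets_boundary (branch_connected l) _ (H l).
    by exists z; split=> //; exact: dE.
  apply: le_trans (diam_ball _ _ _ _ _ (branch_ball l)).
  apply: (@le_trans _ _ (mazurkiewicz Omega y w)).
    apply: ereal_inf_lbound; exists y; first by split=> //; exact: branch_sub by1.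
    by exists w => //; split=> //; exact: branch_sub bw.
  apply: ereal_inf_lbound; exists (b l) => //; split=> //.
    exact: branch_connected.
  exact: branch_sub.
apply/lee_addgt0Pr => e e0; rewrite add0e.
(* The factor [n.+1] in place of [n] keeps the divisor positive when [n = 0]. *)
have n0 : 0 < (n.+1%:R *+ 2) :> R by rewrite mulrn_wgt0.
have [l le] := radius_small (e / (n.+1%:R *+ 2)) (divr_gt0 e0 n0).
apply: (le_trans (small l)); rewrite lee_fin.
move: le; rewrite ltr_pdivlMr// => /ltW; apply: le_trans.
rewrite -mulr2n mulrnAr mulrnAr lerMn2r /= mulrC ler_wpM2l ?ler_nat//.
by rewrite ltW// radius_gt0.
Qed.

End one_branch.

Lemma branch_eq b c : branch b -> branch c ->
  (forall k, b k `&` c k !=set0) -> b = c.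
Proof.
move=> hb hc bc; apply/funext => k.
exact: components_eq (branch_component _ hb k) (branch_component _ hc k) (bc k).
Qed.

(** Nesting comes for free: [b k.+1] is a connected subset of [nbhd k] that meets the component
    [b k]. *)
Lemma branch_of_components (b : nat -> set 'rV[R]_n) :
  (forall k, components (nbhd k) (b k)) ->
  (forall k, b k `&` b k.+1 !=set0) -> branch b.
Proof.
move=> cb bb k; split=> //.
apply: components_max (cb k) (components_connected _ _ _ _ (cb k.+1)) _ (bb k).
exact: subset_trans (components_sub _ _ _ _ (cb k.+1)) (nbhd_sub k).
Qed.

(** The closures of the [E l] are compact and shrink to [x], so a late [E l] lies in [nbhd k], and
    by connectedness in a single component of it. These components form the branch. *)
Lemma chain_branch E : chain Omega E -> chain_impression E = [set x] ->
  exists2 b, branch b & divides E b.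
Proof.
move=> [aE dE ME iE] Ex.
have Emono i j : (i <= j)%N -> E j `<=` E i by exact: nested_le.
have E0 l := acceptable_nonempty _ _ _ _ (aE l).
have EO l : E l `<=` Omega by have [_ _ [] ] := aE l.
have small k : exists l, E l `<=` nbhd k.
  have [|||||l lU] := @compact_nested_sub _ (fun l => closure (E l))
    (ball x (radius_seq k)).
  - apply: bounded_closed_compact; last exact: closed_closure.
    have [M [rM HM]] := bOmega; exists M; split=> // N MN z /= Ez.
    have clN : closed [set t : 'rV[R]_n | `|t| <= N] .
      by apply: compact_closed; [exact: norm_hausdorff|exact: closed_ball0_compact].
    suff : closure (E 0%N) `<=` [set t | `|t| <= N] by exact.
    rewrite [X in _ `<=` X](iffLR (closure_id _) clN).
    by apply: closureS => t /EO Ot; exact: HM Ot.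
  - by move=> l; exact: closed_closure.
  - by move=> l; exact: closureS.
  - exact: ball_open.
  - rewrite -/(chain_impression E) Ex => z ->; apply: ballxx; exact: radius_gt0.
  exists l => z Ez; split; first exact: EO Ez.
  by apply: lU; exact: subset_closure.
have /choice[b hb] : forall k, exists C, components (nbhd k) C /\
    exists l, E l `<=` C.
  move=> k; have [l lk] := small k; have [z Ez] := E0 l.
  exists (connected_component (nbhd k) z); split; first by exists z => //; exact: lk.
  exists l; apply: connected_component_max => //.
  by have [] := aE l.
have Eb : divides E b.
  move=> k; have [_ [l lk]] := hb k; exists l => j lj.
  exact: subset_trans (Emono _ _ lj) lk.
exists b => //; apply: branch_of_components => k; first by case: (hb k).
have [l lb] := Eb k; have [m mb] := Eb k.+1; have [z Ez] := E0 (maxn l m).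
by exists z; split; [apply: lb Ez; exact: leq_maxl|apply: mb Ez; exact: leq_maxr].
Qed.

Definition branch_end (b : nat -> set 'rV[R]_n) : set (nat -> set 'rV[R]_n) :=
  [set F | chain Omega F /\ chain_equiv b F].

Lemma chain_equiv_class E F : chain_equiv E F ->
  [set G | chain Omega G /\ chain_equiv E G] = [set G | chain Omega G /\ chain_equiv F G].
Proof.
move=> [EF FE]; apply/seteqP; split=> G [cG [H1 H2]]; split=> //; split.
- exact: divides_trans FE H1.
- exact: divides_trans H2 EF.
- exact: divides_trans EF H1.
- exact: divides_trans H2 FE.
Qed.

(** If the ends agree, [c] divides [b], so a late [c l] lies in both [b k] and [c k], which are then
    the same component. *)
Lemma branch_end_inj : {in branch &, injective branch_end}.
Proof.
move=> b c; rewrite !inE => hb hc bc.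
have : branch_end b b.
  split; first exact: branch_chain.
  by split; apply: divides_refl; exact: branch_step.
rewrite bc => -[_ [cb _]]; apply: branch_eq => // k.
have [l lb] := cb k; have [z cz] := branch_nonempty c hc (maxn k l).
exists z; split; first by apply: lb cz; exact: leq_maxr.
by apply: branch_mono cz => //; exact: leq_maxl.
Qed.

(** An end dividing this one is represented by a chain dividing [b], and [branch_divides] turns that
    division into an equivalence. *)
Lemma branch_end_prime b : branch b -> prime_end Omega (branch_end b).
Proof.
move=> hb; split; first by exists b => //; exact: branch_chain.
move=> e' [E cE ->] [F [G [[cF EF] [cG bG] FG]]].
have Fb : divides F b by apply: divides_trans FG _; case: bG.
have bF := branch_divides b hb F cF Fb.
by rewrite (chain_equiv_class _ _ EF) /branch_end (chain_equiv_class b F).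
Qed.

Lemma image_branch_end : branch_end @` branch =
  [set e | prime_end Omega e /\ end_has_impression e [set x]].
Proof.
apply/seteqP; split=> [_ [b hb <-]|e [[[E cE ->] _] he]].
  split; first exact: branch_end_prime.
  move=> F [cF [bF Fb]]; rewrite -(branch_impression b hb).
  by apply/seteqP; split; exact: chain_impression_divides.
have EE : divides E E by apply: divides_refl; case: cE.
have [b hb Eb] := chain_branch E cE (he E (conj cE (conj EE EE))).
exists b => //; rewrite /branch_end (chain_equiv_class b E)//; split=> //.
exact: branch_divides.
Qed.

End branches.

(** * Fibers and branches *)

Lemma ptws_eval_continuous (R : realType) (I : eqType) (i : I) :
  continuous (fun f : {ptws I -> R} => f i).
Proof. exact: (@proj_continuous I (fun=> R) i). Qed.

Lemma ptws_cvg (R : realType) (I : Type) (F : set_system {ptws I -> R})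
    (f : {ptws I -> R}) : Filter F ->
  (forall i, g i @[g --> F] --> f i) -> F --> f.
Proof.
move=> FF Ff; apply/cvg_sup => i U [V [[W oW <-] Wf] VU].
apply: filterS VU _; apply: Ff; exact: open_nbhs_nbhs.
Qed.

Lemma ptws_hausdorff (R : realType) (I : eqType) :
  hausdorff_space {ptws I -> R}.
Proof.
apply: (@hausdorff_product I (fun=> R)) => i; exact: Rhausdorff.
Qed.

Lemma ptws_bounded_compact (R : realType) (I : eqType) (M : I -> R) :
  compact [set f : {ptws I -> R} | forall i, `|f i| <= M i].
Proof.
rewrite (_ : mkset _ = [set f | forall i, (fun i => `[- M i, M i]%classic) i (f i)]).
  apply: (@tychonoff I (fun=> R) (fun i => `[- M i, M i]%classic)) => i.
  exact: segment_compact.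
apply/seteqP; split=> f H i; have := H i; rewrite /= in_itv/= ler_norml; exact.
Qed.

Lemma net_tails_filter (I : Type) (le : I -> I -> Prop) :
  directed le -> ProperFilter (net_tails le).
Proof.
move=> [[i0] re tr di]; apply: Build_ProperFilter_ex.
  by move=> P [i Pi]; exists i; exact: Pi.
split.
- by exists i0.
- move=> P Q [i Pi] [j Qj]; have [k [ik jk]] := di i j.
  by exists k => l kl; split; [apply: Pi; exact: tr kl|apply: Qj; exact: tr kl].
- by move=> P Q PQ [i Pi]; exists i => j /Pi /PQ.
Qed.

(** * Localised bump functions in the Royden algebra *)

Section bump_royden.
Context (R : realType) (n : nat) (x : 'rV[R]_n) (rho : R).
Hypothesis rho_gt0 : 0 < rho.
Local Notation phi := (bumpf R n x rho).

Lemma bump_out y : ~ ball x rho y -> phi y = 0.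
Proof.
rewrite ball_rVE// => /existsNP[i /negP].
rewrite /ball /= -leNgt => xy; rewrite /bumpf /posq max_l ?expr0n//.
rewrite /bump_arg subr_le0 (bigD1 i)//= -[leLHS]addr0 lerD//; last first.
  by apply: sumr_ge0 => j _; exact: sqr_ge0.
rewrite -[leRHS]real_normK ?num_real// lerXn2r ?nnegrE ?normr_ge0 ?(ltW rho_gt0)//.
by rewrite distrC.
Qed.

Lemma bump_center : phi x = rho ^+ 2 ^+ 2.
Proof.
rewrite /bumpf /posq /bump_arg big1 ?subr0 => [|j _]; last by rewrite subrr expr0n.
by rewrite max_r// sqr_ge0.
Qed.

Lemma bump_center_gt0 : 0 < phi x.
Proof. by rewrite bump_center !exprn_gt0. Qed.

Lemma bump_lt y : y != x -> phi y < phi x.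
Proof.
move=> yx; rewrite bump_center /bumpf /posq ltrXn2r ?nnegrE ?le_max ?lexx ?sqr_ge0//.
rewrite gt_max exprn_gt0//= /bump_arg ltrBlDr ltrDl lt_neqAle sumr_ge0 ?andbT; last first.
  by move=> j _; exact: sqr_ge0.
apply: contraNN yx => /eqP/esym/psumr_eq0P H; apply/eqP/rowP => i.
apply/eqP; rewrite -subr_eq0 -sqrf_eq0; apply/eqP; apply: H => //.
by move=> j _; exact: sqr_ge0.
Qed.

(** The set [C] is relatively closed in [Omega] only within radius [r], but the bump is already zero
    beyond [rho < r]. Near every point of [Omega] outside [C] the bump therefore vanishes on [C],
    and the cut creates no jump. *)
Lemma bump_royden (Omega C : set 'rV[R]_n) r : (0 < n)%N ->
  open Omega -> bounded_set Omega -> open C -> C `<=` Omega -> rho < r ->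
  (forall y, Omega y -> ball x r y -> ~ C y -> \forall z \near y, ~ C z) ->
  exists u : royden_algebra Omega,
    forall z, set_val u z = (phi \_ C) (set_val z).
Proof.
move=> n0 oO bO oC CO rr hC.
have H : royden_algebra Omega (fun z : Omega => (phi \_ C) (set_val z)).
  apply: (royden_algebra_restr _ _ _ _ _ (dbumpf R n x rho)) => //.
  - exact: continuous_bump.
  - exact: continuous_dbump.
  - by move=> i y; exact: is_derive_bump.
  - move=> y Oy Cy; have [xy|xy] := pselect (ball x r y).
      by apply: filterS (hC y Oy xy Cy) => z Cz /Cz.
    apply/nbhs_ballP; exists (r - rho); first by rewrite /= subr_gt0.
    move=> z yz _; apply: bump_out => xz; apply: xy.
    by have := ball_triangle xz (ball_sym yz); rewrite addrC subrK.
by exists (SigSub (mem_set H)).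
Qed.

End bump_royden.

(** * The fiber over a boundary point and its branches *)

Section fibers.
Context (R : realType) (n : nat) (Omega : set 'rV[R]_n) (x : 'rV[R]_n) (r0 : R).
Hypotheses (n_gt0 : (0 < n)%N) (oOmega : open Omega) (bOmega : bounded_set Omega).
Hypotheses (hx : boundary Omega x) (r0_gt0 : 0 < r0).
Local Notation nbhd := (nbhd R n Omega x r0).
Local Notation radius_seq := (radius_seq R r0).
Local Notation branch := (branch R n Omega x r0).
Local Notation characters := {ptws royden_algebra Omega -> R}.

Definition royden_net (chi : characters) I (le : I -> I -> Prop) (s : I -> Omega) :=
  [/\ directed le, set_val (s i) @[i --> net_tails le] --> x &
    forall u : royden_algebra Omega,
      set_val u (s i) @[i --> net_tails le] --> chi u].

(** Halving the radius leaves the margin required by [bump_royden]. *)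
Definition cutoff k := bumpf R n x (radius_seq k / 2).

Lemma radius2_gt0 k : 0 < radius_seq k / 2.
Proof. by rewrite divr_gt0// radius_gt0. Qed.

Lemma cutoff_component k C : components (nbhd k) C ->
  exists u : royden_algebra Omega,
    forall z, set_val u z = (cutoff k \_ C) (set_val z).
Proof.
move=> kC; apply: (bump_royden _ _ _ _ (radius2_gt0 k) _ _ (radius_seq k)) => //.
- exact: components_open (nbhd_open _ _ _ _ _ oOmega k) _ kC.
- by move=> z /(components_sub _ _ _ _ kC)[].
- by rewrite gtr_pMr ?radius_gt0// invf_lt1// ltr1n.
- move=> y Oy xy Cy.
  by apply: components_closed_in (nbhd_open _ _ _ _ _ oOmega k) _ _ kC _ Cy.
Qed.

(** The bump without truncation, obtained by cutting off to [Omega] itself. Its strict maximum at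
    [x] tells the characters over [x] apart from evaluations at points of [Omega]. *)
Lemma cutoff_domain : exists u : royden_algebra Omega,
  forall z, set_val u z = cutoff 0 (set_val z).
Proof.
have [||u hu] := bump_royden R n x (radius_seq 0 / 2) (radius2_gt0 0) Omega Omega
  (radius_seq 0 / 2 + 1) n_gt0 oOmega bOmega oOmega (@subset_refl _ _).
- by rewrite ltrDl.
- by move=> y Oy _ /(_ Oy).
by exists u => z; rewrite hu restrT//; exact: set_valP.
Qed.

(** * Characters that are limits of evaluations along a filter tending to [x] *)

Section one_filter.
Context (chi : characters) (I : Type) (F : set_system I) (FF : ProperFilter F).
Context (s : I -> Omega).
Hypothesis s_x : set_val (s i) @[i --> F] --> x.
Hypothesis s_chi : forall u : royden_algebra Omega,
  set_val u (s i) @[i --> F] --> chi u.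

Let lim_unique (f : I -> R) (a b : R) : f i @[i --> F] --> a ->
  f i @[i --> F] --> b -> a = b.
Proof. move=> fa fb; apply: (@cvg_unique R (@Rhausdorff R) _ _ a b fa fb). Qed.

Lemma limit_cutoff k :
  cutoff k (set_val (s i)) @[i --> F] --> cutoff k x.
Proof. by apply: cvg_comp s_x _; exact: continuous_bump. Qed.

Lemma limit_value_in k C u : (forall z, set_val u z = (cutoff k \_ C) (set_val z)) ->
  F [set i | C (set_val (s i))] -> chi u = cutoff k x.
Proof.
move=> hu Cs; apply: (lim_unique (fun i => set_val u (s i))) => //.
apply: cvg_trans (limit_cutoff k); apply: (near_eq_cvg).
by apply: filterS Cs => i Ci; rewrite hu restrT.
Qed.

(** A nonzero limit forces the values to be eventually nonzero, and [u] vanishes off [C]. *)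
Lemma limit_in_value k C u : (forall z, set_val u z = (cutoff k \_ C) (set_val z)) ->
  chi u != 0 -> F [set i | C (set_val (s i))].
Proof.
move=> hu u0; have : F [set i | set_val u (s i) != 0].
  have oA : open [set t : R | t != 0] by exact: open_neq.
  exact: (s_chi u _ (open_nbhs_nbhs (conj oA u0))).
apply: filterS => i /=; rewrite hu => Ci; apply: contrapT => nC.
by move: Ci; rewrite restrF// eqxx.
Qed.

Lemma limit_value01 k C u : (forall z, set_val u z = (cutoff k \_ C) (set_val z)) ->
  chi u = 0 \/ chi u = cutoff k x.
Proof.
move=> hu; have [u0|u0] := eqVneq (chi u) 0; first by left.
by right; exact: limit_value_in hu (limit_in_value _ _ _ hu u0).
Qed.

(** The algebraic identities and the bound pass to the limit. An evaluation at [y] would have to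
    give the full bump the value attained only at [x], which is not in [Omega]. *)
Lemma limit_royden_boundary : royden_boundary Omega chi.
Proof.
have [u1 hu1] := cutoff_domain.
have u1x : chi u1 = cutoff 0 x.
  apply: (lim_unique (fun i => set_val u1 (s i))) => //.
  apply: cvg_trans (limit_cutoff 0); apply: (near_eq_cvg).
  by apply: nearW => i; rewrite hu1.
split; last first.
  move=> [y _ yE].
  have : chi u1 = cutoff 0 (set_val y) by rewrite -yE /evaluation hu1.
  rewrite u1x => E.
  have yx : set_val y != x.
    apply/eqP => yx; apply: (x_notin R n Omega x oOmega hx).
    by rewrite -yx; exact: set_valP.
  have := bump_lt R n x (radius_seq 0 / 2) (radius2_gt0 0) _ yx.
  by rewrite -/(cutoff 0) -E ltxx.
split.
- move=> a u v w hw; apply: (lim_unique (fun i => set_val w (s i))) => //.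
  rewrite (_ : (fun i => _) = (fun i => a * set_val u (s i) + set_val v (s i))).
    by apply: cvgD => //; apply: cvgMl_tmp.
  by apply/funext => i; rewrite hw.
- move=> u v w hw; apply: (lim_unique (fun i => set_val w (s i))) => //.
  rewrite (_ : (fun i => _) = (fun i => set_val u (s i) * set_val v (s i))).
    by apply: cvgM.
  by apply/funext => i; rewrite hw.
(* The constant [1] works because the Royden norm dominates the supremum of [u]. *)
- exists 1 => u; rewrite mul1e.
  have le_norm y : (`|set_val u y|%:E <= royden_norm (set_val u))%E.
    rewrite /royden_norm.
    apply: (le_trans (le_Lnorm_infty_continuous _ _ _ (set_val u) y oOmega _)).
      by have [] : royden_algebra Omega (set_val u) by exact: set_valP.
    by rewrite leeDl// Lnorm_ge0.
  have [i0 _] := @filter_ex _ _ FF _ filterT.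
  case E : (royden_norm (set_val u)) => [r| |]; last 2 first.
  + by rewrite leey.
  + by have := le_norm (s i0); rewrite E.
  rewrite lee_fin.
  apply: (@closed_cvg _ _ F _ (fun i => `|set_val u (s i)|) [set t | t <= r]).
  + exact: closed_le.
  + by apply: nearW => i; have := le_norm (s i); rewrite E lee_fin.
  + exact: cvg_norm.
- by exists u1; rewrite u1x gt_eqF// bump_center_gt0// radius2_gt0.
Qed.

End one_filter.

(** Evaluation made total on the ambient space, with value zero off [Omega], so that images of plain
    subsets of the space can be formed. *)
Definition ext_evaluation (y : 'rV[R]_n) : characters :=
  fun u => 'valL_(0 : R) (set_val u) y.

Lemma ext_evaluationE (z : Omega) u :
  ext_evaluation (set_val z) u = set_val u z.
Proof. exact: (congr1 (fun h => h z) (valLK (0 : R) (set_val u))). Qed.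

Lemma ext_evaluation_continuous : {within Omega, continuous ext_evaluation}.
Proof.
move=> y; apply: ptws_cvg => u.
have : {within Omega, continuous ('valL_(0 : R) (set_val u))}.
  apply/subspace_sigL_continuousP; rewrite valLK.
  by have [] : royden_algebra Omega (set_val u) by exact: set_valP.
exact.
Qed.

Definition branch_fiber (b : nat -> set 'rV[R]_n) : set characters :=
  \bigcap_k closure (ext_evaluation @` b k).

(** Each [u] is bounded, so the evaluations lie in a product of segments, which is compact by
    Tychonoff. *)
Lemma closure_ext_evaluation_compact (C : set 'rV[R]_n) : C `<=` Omega ->
  compact (closure (ext_evaluation @` C)).
Proof.
move=> CO.
have /choice[M hM] : forall u : royden_algebra Omega,
    exists M : R, forall z : Omega, `|set_val u z| <= M.
  by move=> u; have [] : royden_algebra Omega (set_val u) by exact: set_valP.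
have cM := ptws_bounded_compact R _ M.
apply: (subclosed_compact _ cM); first exact: closed_closure.
rewrite [X in _ `<=` X](iffLR (closure_id _)); last first.
  by apply: compact_closed cM; exact: ptws_hausdorff.
apply: closureS => _ [y Cy <-] u.
by rewrite -[y]/(set_val (SigSub (mem_set (CO _ Cy)) : Omega)) ext_evaluationE.
Qed.

Lemma branch_fiber_step b k : branch b ->
  closure (ext_evaluation @` b k.+1) `<=` closure (ext_evaluation @` b k).
Proof.
move=> hb; apply: closureS => _ [y by1 <-]; exists y => //.
exact: branch_step hb _ _ by1.
Qed.

Lemma branch_fiber_nonempty b : branch b -> branch_fiber b !=set0.
Proof.
move=> hb; apply: nested_nonempty => [||k|k].
- by apply: closure_ext_evaluation_compact; exact: branch_sub hb _.
- by move=> k; exact: closed_closure.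
- exact: branch_fiber_step.
- have [y by1] := branch_nonempty _ _ _ _ _ _ hb k.
  by exists (ext_evaluation y); apply: subset_closure; exists y.
Qed.

Lemma branch_fiber_connected b : branch b -> connected (branch_fiber b).
Proof.
move=> hb; apply: connected_nested => [|||k|k].
- exact: ptws_hausdorff.
- by apply: closure_ext_evaluation_compact; exact: branch_sub hb _.
- by move=> k; exact: closed_closure.
- exact: branch_fiber_step.
- apply: connected_closure; apply: connected_continuous_connected.
    exact: branch_connected hb k.
  apply: continuous_subspaceW ext_evaluation_continuous.
  exact: branch_sub hb k.
Qed.

Lemma limit_branch_fiber b (chi : characters) I (F : set_system I) (s : I -> Omega) :
  ProperFilter F ->
  (forall u : royden_algebra Omega, set_val u (s i) @[i --> F] --> chi u) ->
  (forall k, \forall i \near F, b k (set_val (s i))) -> branch_fiber b chi.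
Proof.
move=> FF s_chi sb k _ V Vchi.
have s_V : ext_evaluation (set_val (s i)) @[i --> F] --> chi.
  apply: ptws_cvg => u W Wu; apply: (@filterS _ F _ _ _ _ (s_chi u W Wu)) => i /=.
  by rewrite ext_evaluationE.
have [i [bi Vi]] := @filter_ex _ F _ _ (filterI (sb k) (s_V V Vchi)).
by exists (ext_evaluation (set_val (s i))); split=> //; exists (set_val (s i)).
Qed.

Lemma branch_fiber_net b (chi : characters) : branch b -> branch_fiber b chi ->
  exists (I : Type) (le : I -> I -> Prop) (s : I -> Omega),
    royden_net chi I le s /\
    forall k, net_tails le [set i | b k (set_val (s i))].
Proof.
move=> hb bchi.
(* Indices are triples of a point, a level [k] and a neighbourhood of [chi], with the point in [b k]
   and its evaluation in the neighbourhood. They are ordered by level and reverse inclusion, which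
   gives convergence to [x] and to [chi] at once. *)
pose I := {p : Omega * nat * set characters |
  [/\ nbhs chi p.2, b p.1.2 (set_val p.1.1) & p.2 (evaluation p.1.1)]}.
pose le (i j : I) := ((sval i).1.2 <= (sval j).1.2)%N /\ (sval j).2 `<=` (sval i).2.
have point k V : nbhs chi V -> exists i : I, (sval i).1.2 = k /\ (sval i).2 = V.
  move=> Vchi; have [_ [[y bky <-] Vy]] := bchi k Logic.I V Vchi.
  pose z : Omega := SigSub (mem_set (branch_sub _ _ _ _ _ _ hb _ _ bky)).
  suff h : [/\ nbhs chi V, b k (set_val z) & V (evaluation z)].
    by exists (exist _ (z, k, V) h).
  split=> //; rewrite (_ : evaluation z = ext_evaluation y)//.
  by apply/funext => u; exact: (esym (ext_evaluationE z u)).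
have dle : directed le.
  split.
  - by have [i _] := point 0%N setT filterT; exists.
  - by move=> i; split.
  - move=> i j k [ij ji] [jk kj]; split; first exact: leq_trans jk.
    exact: subset_trans ji.
  - move=> i j; have [[iV _ _] [jV _ _]] := (svalP i, svalP j).
    have [k [kE VE]] := point (maxn (sval i).1.2 (sval j).1.2) _ (filterI iV jV).
    exists k; rewrite /le kE VE leq_maxl leq_maxr; split; split=> // z [].
pose s (i : I) := (sval i).1.1.
have sb k : net_tails le [set i | b k (set_val (s i))].
  have [i0 [iE _]] := point k setT filterT; exists i0 => j [ij _].
  have [_ bj _] := svalP j; move: ij; rewrite iE => ij.
  exact: branch_mono hb _ _ ij _ bj.
have sV V : nbhs chi V -> net_tails le [set i | V (evaluation (s i))].
  move=> Vchi; have [i0 [_ iE]] := point 0%N V Vchi; exists i0 => j [_ ij].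
  by have [_ _ Vj] := svalP j; rewrite iE in ij; exact: ij.
exists I, le, s; split=> //; split=> //.
- move=> V /nbhs_ballP[e /= e0 eV]; have [k ke] := radius_small _ _ r0_gt0 e e0.
  have [i0 Hi] := sb k; exists i0 => j /Hi /= bj.
  apply: eV; apply: le_ball (ltW ke) _ _.
  exact: branch_ball hb _ _ bj.
- move=> u V Vu; apply: (sV [set f : characters | V (f u)]).
  exact: (ptws_eval_continuous R _ u chi V Vu).
Qed.

Lemma branch_fiber_sub b : branch b -> branch_fiber b `<=` fiber Omega x.
Proof.
move=> hb chi bchi.
have [I [le [s [[dle s_x s_chi] _]]]] := branch_fiber_net b chi hb bchi.
split; last by exists I, le, s.
exact: (limit_royden_boundary _ _ _ (net_tails_filter _ _ dle) _ s_x s_chi).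
Qed.

(** The bump cut off to [b k] is nonzero at a common character [chi]. A net along [c] converging to
    [chi] must then enter [b k], so [b k] and [c k] meet. *)
Lemma branch_fiber_inj : {in branch &, injective branch_fiber}.
Proof.
move=> b c; rewrite !inE => hb hc bc; apply: (branch_eq R n Omega x r0 b c hb hc) => k.
have [chi bchi] := branch_fiber_nonempty b hb.
have [u hu] := cutoff_component k (b k) (branch_component _ _ _ _ _ _ hb k).
have [I [le [s [[dle s_x s_chi] sb]]]] := branch_fiber_net b chi hb bchi.
have uE := limit_value_in chi _ _ (net_tails_filter _ _ dle) _ s_x s_chi _ _ _ hu (sb k).
rewrite bc in bchi.
have [J [le' [t [[dle' t_x t_chi] tc]]]] := branch_fiber_net c chi hc bchi.
have u0 : chi u != 0 by rewrite uE gt_eqF// bump_center_gt0// radius2_gt0.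
have tb := limit_in_value chi _ _ (net_tails_filter _ _ dle') _ t_chi _ _ _ hu u0.
have FF' := net_tails_filter _ _ dle'.
have [j [bj cj]] := @filter_ex _ _ FF' _ (@filterI _ _ FF' _ _ tb (tc k)).
by exists (set_val (t j)).
Qed.

(** On the fiber, evaluation at the bump cut off to [b k] takes only two values. On a connected
    subset containing [chi] it keeps the nonzero one, which forces the nets of all its members into
    [b k]. *)
Lemma fiber_component b (chi : characters) : branch b -> branch_fiber b chi ->
  connected_component (fiber Omega x) chi = branch_fiber b.
Proof.
move=> hb bchi; apply/seteqP; split; last first.
  apply: connected_component_max => //; first exact: branch_fiber_sub.
  exact: branch_fiber_connected.
move=> psi [D [Dchi DF cD] Dpsi].
have [_ [I [le [s [dle s_x s_psi]]]]] := DF psi Dpsi.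
have FF := net_tails_filter _ _ dle.
apply: (limit_branch_fiber b psi I (net_tails le) s FF s_psi) => k.
have [u hu] := cutoff_component k (b k) (branch_component _ _ _ _ _ _ hb k).
apply: (limit_in_value psi _ _ (net_tails_filter _ _ dle) s s_psi _ _ _ hu).
have x0 : 0 < cutoff k x by rewrite bump_center_gt0// radius2_gt0.
have h0 : 0 < cutoff k x / 2 by rewrite divr_gt0.
have hlt : cutoff k x / 2 < cutoff k x by rewrite gtr_pMr// invf_lt1// ltr1n.
have cu := ptws_eval_continuous R _ u.
suff : D `<=` [set f : characters | cutoff k x / 2 < f u].
  by move=> /(_ psi Dpsi) /= H; rewrite gt_eqF// (lt_trans h0).
apply: (connected_sub_open _ _ _ [set f : characters | f u < cutoff k x / 2]) => //.
- apply: (@open_comp _ _ (fun f : characters => f u) [set t | cutoff k x / 2 < t]).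
    by move=> f _; exact: cu.
  exact: open_gt.
- apply: (@open_comp _ _ (fun f : characters => f u) [set t | t < cutoff k x / 2]).
    by move=> f _; exact: cu.
  exact: open_lt.
- move=> f Df; have [_ [J [le' [t [dle' t_x t_f]]]]] := DF f Df.
  have := limit_value01 f _ _ (net_tails_filter _ _ dle') t t_x t_f _ _ _ hu.
  by move=> [fE|fE]; [right|left]; rewrite /= fE.
- by apply/seteqP; split=> // f [[_ /= f1] f2]; have := lt_trans f1 f2; rewrite ltxx.
- exists chi; split=> //=.
  have [J [le' [t [[dle' t_x t_chi] tb]]]] := branch_fiber_net b chi hb bchi.
  have FF' := net_tails_filter _ _ dle'.
  by rewrite (limit_value_in chi _ _ FF' _ t_x t_chi _ _ _ hu (tb k)).
Qed.

(** * Finite connectedness: each character of the fiber selects a branch *)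

Hypothesis hfc : finitely_connected_at_boundary Omega.

(** A component of [nbhd k] that comes within [delta] of [x] contains a component of [U] in [Omega],
    and there are finitely many of the latter. The map [f] recovers the large component from any
    point of the small one. *)
Lemma finite_components_near k : exists2 delta, 0 < delta &
  finite_set [set C | components (nbhd k) C /\ C `&` ball x delta !=set0].
Proof.
have [U [oU _ Ux Ur fU]] := hfc x (radius_seq k) hx (radius_gt0 _ _ r0_gt0 k).
have [d /= d0 dU] : nbhs_ball x U by apply/nbhs_ballP; exact: open_nbhs_nbhs.
have UON : U `&` Omega `<=` nbhd k.
  move=> z [Uz Oz]; split=> //; rewrite -ball_normE /ball_/=.
  exact: le_lt_trans (enorm_ge_norm _ _ _) (Ur z Uz).
exists d => //.
pose f (V : set 'rV[R]_n) := connected_component (nbhd k) (get V).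
apply: (@sub_finite_set _ _ (f @` components (U `&` Omega))); last exact: finite_image.
move=> C [kC [z [Cz zx]]].
have Oz : Omega z by have [] := components_sub _ _ _ _ kC _ Cz.
have Uz : U z by exact: dU.
pose V := connected_component (U `&` Omega) z.
have Vz : V z by exact: connected_component_refl.
exists V; first by exists z.
have Vg : V (get V) by apply: getPex; exists z.
have VC : V `<=` C.
  apply: (components_max R n (nbhd k) C V kC).
  - exact: component_connected.
  - by apply: subset_trans UON; exact: connected_component_sub.
  - by exists z.
have Cg : C (get V) by exact: VC.
have Ng : nbhd k (get V) by exact: components_sub _ _ _ _ kC _ Cg.
rewrite /f; apply: (components_eq R n (nbhd k)) => //; first by exists (get V).
by exists (get V); split=> //; exact: connected_component_refl.
Qed.

(** If no component captured the filter, [chi] would vanish on every truncated bump. As only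
    finitely many components come near [x], the bump would eventually be below half its maximum at
    the points [s i], whereas it tends to the maximum there. *)
Lemma limit_component (chi : characters) I (F : set_system I) (s : I -> Omega) k :
  ProperFilter F -> set_val (s i) @[i --> F] --> x ->
  (forall u : royden_algebra Omega, set_val u (s i) @[i --> F] --> chi u) ->
  exists C, components (nbhd k) C /\ F [set i | C (set_val (s i))].
Proof.
move=> FF s_x s_chi; have [d d0 fin] := finite_components_near k.
apply: contrapT => /forallNP noC.
have x0 : 0 < cutoff k x by rewrite bump_center_gt0// radius2_gt0.
have small C : components (nbhd k) C ->
    F [set i | ~ C (set_val (s i)) \/ cutoff k (set_val (s i)) < cutoff k x / 2].
  move=> kC; have [u hu] := cutoff_component k C kC.
  have u0 : chi u = 0.
    apply/eqP/negPn/negP => u0; apply: (noC C); split=> //.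
    exact: (limit_in_value chi _ _ _ s s_chi _ _ _ hu u0).
  have := s_chi u; rewrite u0 => /cvgr0_norm_lt /(_ _ (divr_gt0 x0 (ltr0n _ 2))).
  apply: filterS => i; rewrite hu.
  have [Ci|Ci] := pselect (C (set_val (s i))); last by left.
  by rewrite restrT// => /ltr_normlW; right.
have /finite_seqP[cs csE] := fin.
have kcs C : C \in cs -> components (nbhd k) C.
  move=> Ccs.
  suff : [set C | components (nbhd k) C /\ C `&` ball x d !=set0] C by case.
  by rewrite csE.
(* Finiteness enters here: a filter is closed under finite intersections only. *)
have Fcs : F [set i | forall C, C \in cs ->
    ~ C (set_val (s i)) \/ cutoff k (set_val (s i)) < cutoff k x / 2].
  elim: cs kcs {csE} => [_|C cs ih kcs]; first by apply: filterE.
  have kcs' D : D \in cs -> components (nbhd k) D.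
    by move=> Dcs; apply: kcs; rewrite inE Dcs orbT.
  have := @filterI _ F FF _ _ (small C (kcs C (mem_head _ _))) (ih kcs').
  by apply: (@filterS _ F FF) => i [H1 H2] D; rewrite inE => /predU1P[->|/H2].
have Fx : F [set i | cutoff k x / 2 < cutoff k (set_val (s i))].
  apply: (cvgr_gt (cutoff k x)); last by rewrite gtr_pMr// invf_lt1// ltr1n.
  exact: limit_cutoff.
have Fd : F [set i | nbhd k (set_val (s i)) /\ ball x d (set_val (s i))].
  have r1 := radius_gt0 _ _ r0_gt0 k.
  have := @filterI _ F FF _ _ (s_x _ (nbhsx_ballx x _ r1)) (s_x _ (nbhsx_ballx x _ d0)).
  by apply: (@filterS _ F FF) => i [H1 H2]; do 2?split => //; exact: set_valP.
have [i [Hcs [Hx [Hk Hd]]]] := @filter_ex _ F FF _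
  (@filterI _ F FF _ _ Fcs (@filterI _ F FF _ _ Fx Fd)).
have Ccs : connected_component (nbhd k) (set_val (s i)) \in cs.
  suff : [set` cs] (connected_component (nbhd k) (set_val (s i))) by [].
  rewrite -csE; split; first by exists (set_val (s i)).
  by exists (set_val (s i)); split=> //; exact: connected_component_refl.
have [|H] := Hcs _ Ccs; first by apply; exact: connected_component_refl.
by have := lt_trans Hx H; rewrite ltxx.
Qed.

Lemma fiber_branch (chi : characters) : fiber Omega x chi ->
  exists2 b, branch b & branch_fiber b chi.
Proof.
move=> [_ [I [le [s [dle s_x s_chi]]]]]; have FF := net_tails_filter _ _ dle.
have /choice[b hb] : forall k, exists C, components (nbhd k) C /\
    net_tails le [set i | C (set_val (s i))].
  by move=> k; exact: limit_component FF s_x s_chi.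
exists b; last first.
  by apply: limit_branch_fiber FF s_chi _ => k; case: (hb k).
apply: branch_of_components => // k; first by case: (hb k).
have [_ H1] := hb k; have [_ H2] := hb k.+1.
have [i [i1 i2]] := @filter_ex _ _ FF _ (@filterI _ _ FF _ _ H1 H2).
by exists (set_val (s i)).
Qed.

Lemma image_branch_fiber : branch_fiber @` branch = components (fiber Omega x).
Proof.
apply/seteqP; split=> [_ [b hb <-]|_ [chi hchi <-]].
  have [chi bchi] := branch_fiber_nonempty b hb.
  exists chi; first exact: branch_fiber_sub bchi.
  exact: fiber_component.
have [b hb bchi] := fiber_branch chi hchi; exists b => //.
by rewrite (fiber_component b).
Qed.

End fibers.

(** * Assembly of the bijection from the two parametrisations *)

Lemma set_bij_images (P A B : Type) (X : set P) (f : P -> A) (g : P -> B)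
    (p0 : P) : {in X &, injective f} -> {in X &, injective g} ->
  exists h, set_bij (f @` X) (g @` X) h.
Proof.
move=> finj ginj.
(* Injectivity of [f] makes the value [g p] independent of [p]; off the image of [X] the value
   [g p0] is a mere default. *)
have /choice[h hE] : forall a, exists b, forall p, X p -> f p = a -> b = g p.
  move=> a; have [[p [Xp fp]]|nop] := pselect (exists p, X p /\ f p = a).
    by exists (g p) => q Xq fq; congr g; apply: finj; rewrite ?inE// fp.
  by exists (g p0) => p Xp fp; case: nop; exists p.
have {}hE p : X p -> h (f p) = g p by move=> Xp; exact: hE.
exists h; split.
- by move=> _ [p Xp <-]; rewrite hE//; exists p.
- move=> a b /set_mem[p Xp <-] /set_mem[q Xq <-]; rewrite !hE// => gpq.
  by congr f; apply: ginj; rewrite ?inE.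
- by move=> _ [p Xp <-]; exists (f p); [exists p|rewrite hE].
Qed.

Theorem theorem8 (R : realType) (n : nat) (Omega : set 'rV[R]_n)
    (hn : (2 <= n)%N) (hOmega : bounded_domain Omega)
    (hfc : finitely_connected_at_boundary Omega)
    (x : 'rV[R]_n) (hx : boundary Omega x) :
  exists f : set {ptws royden_algebra Omega -> R} ->
             set (nat -> set 'rV[R]_n),
    set_bij (components (fiber Omega x))
            [set e | prime_end Omega e /\ end_has_impression e [set x]] f.
Proof.
have [oOmega _ [y0 Oy0] bOmega] := hOmega.
have n_gt0 : (0 < n)%N by exact: leq_trans hn.
(* With this radius the open ball around [x] misses the point [y0] of [Omega]. *)
pose r0 := `|x - y0|.
have r0_gt0 : 0 < r0.
  rewrite normr_gt0 subr_eq0; apply/eqP => xy.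
  by apply: (x_notin R n Omega x oOmega hx); rewrite xy.
have Omega_out : ~ Omega `<=` ball x r0.
  by move=> /(_ _ Oy0); rewrite -ball_normE /ball_/= ltxx.
rewrite -(image_branch_end R n Omega x r0)// -(image_branch_fiber R n Omega x r0)//.
apply: set_bij_images; first exact: (fun=> set0).
- exact: branch_fiber_inj.
- exact: branch_end_inj.
Qed.
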